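(* (i) For $m=n=2$ and every $H\in\mathbb S_{++}^4$, the unique affine-invariant projection $P_{\mathcal K_{2,2}}(H)$ is a global minimizer of $G\mapsto\kappa(G^{-1}H)$ over $G\in\mathcal K_{2,2}$. (ii) Consequently, if $m,n\ge2$ and there exists $H\in\mathbb S_{++}^{mn}$ such that $P_{\mathcal K_{m,n}}(H)$ is not a minimizer of $G\mapsto\kappa(G^{-1}H)$ over $\mathcal K_{m,n}$, then $mn\ge 6$. (iii) The bound in (ii) is attained with $(m,n)=(2,3)$: for $A=\operatorname{diag}(1,-1)$, $B=\operatorname{diag}(2,-\tfrac12,-\tfrac32)$ and $H=\exp(B\otimes A)\in\mathbb S_{++}^6$, the projection $P_{\mathcal K_{2,3}}(H)$ is not a minimizer of $\kappa(G^{-1}H)$ over $\mathcal K_{2,3}$. Hence this construction is dimension-minimal among real two-factor positive-definite Kronecker families (with both factors of dimension at least two).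
   Context: $\mathbb S_{++}^d$ denotes real symmetric positive-definite $d\times d$ matrices. The affine-invariant distance is $d_{\mathrm{AI}}(G_0,G_1)=\|\log(G_0^{-1/2}G_1G_0^{-1/2})\|_F$. For $G,H\in\mathbb S_{++}^d$, $\kappa(G^{-1}H)$ is the ratio of the largest to the smallest generalized eigenvalue in $Hv=\lambda Gv$. The Kronecker family is $\mathcal K_{m,n}=\{B\otimes A: A\in\mathbb S_{++}^m,\ B\in\mathbb S_{++}^n\}\subset\mathbb S_{++}^{mn}$. For every $M\in\mathbb S_{++}^{mn}$ there is a unique point $P_{\mathcal K_{m,n}}(M)=\operatorname*{arg\,min}_{G\in\mathcal K_{m,n}}d_{\mathrm{AI}}(M,G)$. *)

(* Defs.v *)
From HB Require Import structures.
From mathcomp Require Import all_boot all_order all_algebra.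
From mathcomp Require Import mxtens.
From mathcomp Require Import all_classical all_reals all_analysis.

Set Implicit Arguments.
Unset Strict Implicit.
Unset Printing Implicit Defensive.

Import Order.TTheory GRing.Theory Num.Theory.
Import numFieldNormedType.Exports.

Local Open Scope classical_set_scope.
Local Open Scope ring_scope.

Definition is_argmin (R : realType) (T : Type) (K : set T) (f : T -> R) (x : T) : Prop :=
  K x /\ forall y, K y -> f x <= f y.

Section MatrixFunctions.
Variables (R : realType) (d : nat).
Implicit Types A G H L S : 'M[R]_d.

Definition spd A : Prop :=
  A^T = A /\ forall v : 'cV[R]_d, v != 0 -> 0 < (v^T *m A *m v) 0 0.

Definition expmx A : 'M[R]_d :=
  limn (series (fun k : nat => (k`!%:R)^-1 *: (A ^+ k))).

(* On SPD arguments each of the two sets below is a singleton, so [get] returns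
   the principal logarithm and the positive-definite square root; the junk value
   of [get] on an empty set only concerns other arguments. *)
Definition logmx A : 'M[R]_d := get [set L | L^T = L /\ expmx L = A].

Definition sqrtmx A : 'M[R]_d := get [set S | spd S /\ S *m S = A].

Definition frobenius A : R := Num.sqrt (\sum_i \sum_j A i j ^+ 2).

Definition dAI G H : R :=
  let S := invmx (sqrtmx G) in frobenius (logmx (S *m H *m S)).

Definition gen_eigenvalues G H : set R :=
  [set a | exists2 v : 'cV[R]_d, v != 0 & H *m v = a *: (G *m v)].

(* kappa G H stands for kappa(G^-1 H).  For SPD G, H and d > 0 the set of
   generalized eigenvalues is finite and nonempty, hence sup and inf are its
   largest and smallest elements. *)
Definition kappa G H : R :=
  sup (gen_eigenvalues G H) / inf (gen_eigenvalues G H).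

End MatrixFunctions.

Section KroneckerFamily.
Variables (R : realType) (m n : nat).

(* [B *t A] is the Kronecker product, block (i, j) of which is B i j *: A; its
   type is 'M_(n * m), so that is how S_{++}^{mn} is represented. *)
Definition kron_family : set 'M[R]_(n * m) :=
  [set G | exists A : 'M[R]_m, exists B : 'M[R]_n,
     [/\ spd A, spd B & G = B *t A]].

(* P = P_{K_{m,n}}(H), i.e. P is the unique minimizer of d_AI(H, -). *)
Definition is_kron_proj (H P : 'M[R]_(n * m)) : Prop :=
  unique (is_argmin kron_family (dAI H)) P.

Definition is_kappa_minimizer (H G : 'M[R]_(n * m)) : Prop :=
  is_argmin kron_family (fun G' => kappa G' H) G.

Definition kron_proj_not_optimal (H : 'M[R]_(n * m)) : Prop :=
  exists P, is_kron_proj H P /\ ~ is_kappa_minimizer H P.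

End KroneckerFamily.

Arguments is_kron_proj {R} m n H P.
Arguments is_kappa_minimizer {R} m n H G.
Arguments kron_proj_not_optimal {R} m n H.

Definition exA (R : realType) : 'M[R]_2 :=
  diag_mx (\row_(j < 2) [:: 1; -1]`_j).

Definition exB (R : realType) : 'M[R]_3 :=
  diag_mx (\row_(j < 3) [:: 2; - (1 / 2); - (3 / 2)]`_j).

(* Main.v *)
Require Import Defs.
From mathcomp Require Import all_boot all_order all_algebra.
From mathcomp Require Import mxtens complex spectral.
From mathcomp Require Import all_classical all_reals all_analysis.
From mathcomp Require Import ring lra zify.

(** Everything rests on one inequality of Hadamard geometry, the exponential metric
    increasing property [exp_metric_increasing]: if [X *m X^T = expmx L] and
    [X *m expmx Z *m X^T = expmx Y] then [|Y - L| <= |Z|] in Frobenius norm, and [|Z|]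
    is the affine-invariant distance ([dAI_expmx]). It is proved without
    differentiating matrix functions. For two symmetric matrices, expanding in their
    two eigenbases and using [x ^+ 2 <= expR x + expR (- x) - 2] bounds the square of
    [|Y - L|] by a trace that is invariant under congruence ([log_dist_le_trace]);
    chaining this bound along a finely subdivided geodesic gives the result.
    A Pythagorean criterion follows ([proj_of_orthogonal_log]): after the congruence
    that moves a point of the family to the identity, that point is the unique
    projection of [H] once the logarithm of [H] is orthogonal to the logarithms of
    the family.

    For two by two factors, let [Q] be [detform], the determinant viewed as a
    quadratic form on two by two matrices. The Kronecker family consists of the
    positive-definite [G] with [G *m Q *m G = k *: Q], [k > 0]
    ([kron_family2_detform], [kron_family2_of_detform]); up to scaling it is the
    fixed set of the isometry [G |-> Q *m invmx G *m Q]. The projection of [H] is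
    therefore the geometric mean of [H] and its image, rescaled. In the frame [S] of
    that mean, [H] becomes [expmx L] with [L] traceless and commuting with [Q]
    ([involution_normal_form]), whereas logarithms of the family anticommute with [Q]
    up to scalars; orthogonality is immediate ([involution_log_orth]). Commutation
    also provides extreme eigenvectors of [expmx L] that are eigenvectors of [Q],
    that is, multiples of orthogonal two by two matrices, and on such vectors the
    forms [G] and [invmx G] are too large for any [G] in the family to improve the
    condition number ([kappa_involution_min]). The dimension bound follows, since
    two by two factors are the only ones with [2 <= m], [2 <= n] and [m * n < 6].

    For two by three factors, [exB *t exA] is a product of traceless matrices and so
    is orthogonal to every Kronecker sum, which makes the identity the projection
    ([kron_proj1_of_traceless]), while [1%:M *t expmx (4^-1 *: exA)] has a smaller
    condition number ([kappa_example_lt]). *)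

Set Implicit Arguments.
Unset Strict Implicit.
Unset Printing Implicit Defensive.

Import Order.TTheory GRing.Theory Num.Theory.
Import numFieldNormedType.Exports.
Local Open Scope ring_scope.

(** * The spectral theorem for real symmetric matrices *)

(** A Hermitian matrix over the complex extension of [R] has a real spectrum, so
    the characteristic polynomial of the real matrix [A] has a root in [R]. *)
Lemma sym_eigenvalue (R : rcfType) n (A : 'M[R]_n.+1) :
  A^T = A -> exists a, eigenvalue A a.
Proof.
move=> symA; pose AC := map_mx (real_complex R) A.
have hermA : AC \is hermsymmx.
  apply: realsym_hermsym.
    apply/is_hermitianmxP; rewrite expr0 scale1r map_mx_id //.
    by rewrite /AC map_trmx symA.
  by apply/mxOverP => i j; rewrite !mxE complex_real.
have /mxOverP/(_ 0 0) := hermitian_spectral_diag_real hermA.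
move=> /complex_realP[a Da]; exists a.
rewrite eigenvalue_root_char -(fmorph_root (real_complex R)) map_char_poly.
rewrite -eigenvalue_root_char; apply/eigenvalueP.
have /orthomx_spectralP decA := hermitian_normalmx hermA.
have uP := spectral_unit AC.
exists (row 0 (spectralmx AC)); last first.
  apply/eqP => /(congr1 (fun x => (x *m invmx (spectralmx AC)) 0 0)).
  by rewrite -row_mul mulmxV // mul0mx !mxE => /eqP; rewrite oner_eq0.
rewrite -/AC -row_mul {2}decA !mulmxA mulmxV // mul1mx row_mul.
by rewrite row_diag_mx -scalemxAl Da -rowE.
Qed.

Lemma rV_sqr_ge0 (R : realDomainType) n (v : 'rV[R]_n) : 0 <= (v *m v^T) 0 0.
Proof.
by rewrite !mxE; apply: sumr_ge0 => i _; rewrite mxE -expr2 sqr_ge0.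
Qed.

Lemma rV_sqr_gt0 (R : realDomainType) n (v : 'rV[R]_n) :
  (0 < (v *m v^T) 0 0) = (v != 0).
Proof.
rewrite lt_def rV_sqr_ge0 andbT; congr (~~ _); apply/eqP/eqP => [|->].
  rewrite !mxE => /eqP; rewrite psumr_eq0; last first.
    by move=> i _; rewrite mxE -expr2 sqr_ge0.
  move=> /allP v0; apply/rowP => j; rewrite mxE.
  by have := v0 j (mem_index_enum _); rewrite /= mxE mulf_eq0 orbb => /eqP.
by rewrite mul0mx mxE.
Qed.

(** The Householder reflection in [v - e], with [e] the first basis vector,
    exchanges [e] and [v]. *)
Lemma orthogonal_first_row (R : realFieldType) n (v : 'rV[R]_n.+1) :
  v *m v^T = 1%:M ->
  exists V : 'M[R]_n.+1, [/\ V^T = V, V *m V = 1%:M & row 0 V = v].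
Proof.
move=> v1; pose e : 'rV[R]_n.+1 := delta_mx 0 0.
have [<-|ve] := eqVneq e v.
  by exists 1%:M; rewrite trmx1 mulmx1 row1.
pose w := v - e; pose c := (w *m w^T) 0 0.
have c0 : c != 0 by rewrite gt_eqF // rV_sqr_gt0 subr_eq0 eq_sym.
have wwT : w *m w^T = c%:M by exact: mx11_scalar.
have eeT : e *m e^T = 1%:M.
  by apply/rowP => i; rewrite ord1 trmx_delta mul_delta_mx !mxE.
have veT : v *m e^T = (v 0 0)%:M.
  by apply/rowP => i; rewrite ord1 trmx_delta -colE !mxE mulr1n.
have evT : e *m v^T = (v 0 0)%:M.
  by rewrite -[LHS]trmxK trmx_mul trmxK veT tr_scalar_mx.
have cE : c = 2 - 2 * v 0 0.
  rewrite /c /w linearB /= mulmxBl !mulmxBr v1 veT evT eeT.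
  by rewrite !mxE /= !mulr1n; ring.
exists (1%:M - (2 / c) *: (w^T *m w)); split.
- by rewrite linearB /= trmx1 linearZ /= trmx_mul trmxK.
- set X := _ *: _; have XX : X *m X = X + X.
    rewrite /X -scalemxAl -scalemxAr mulmxA -[w^T *m w *m w^T]mulmxA wwT.
    rewrite mul_mx_scalar -scalemxAl !scalerA -scalerDl.
    by congr (_ *: _); field.
  by rewrite mulmxBl mul1mx mulmxBr mulmx1 XX opprB addrK subrK.
- rewrite rowE -/e; set X := _ *: _.
  rewrite (mulmxBr e 1%:M X) mulmx1 /X -scalemxAr mulmxA.
  have -> : e *m w^T = (v 0 0 - 1)%:M.
    by rewrite /w linearB /= mulmxBr evT eeT -raddfB.
  rewrite mul_scalar_mx scalerA.
  have -> : 2 / c * (v 0 0 - 1) = -1 by rewrite cE; field; rewrite -cE.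
  by rewrite scaleN1r opprK addrC subrK.
Qed.

(** Induction on the dimension: a reflection carrying the first basis vector to a
    unit eigenvector splits off a one by one block. *)
Lemma spectral_theorem (R : rcfType) n (A : 'M[R]_n) : A^T = A ->
  exists (U : 'M[R]_n) (d : 'rV[R]_n),
    U *m U^T = 1%:M /\ A = U *m diag_mx d *m U^T.
Proof.
elim: n A => [|n IHn] A symA.
  by exists 1%:M, 0; rewrite trmx1 mulmx1; split => //; apply/matrixP=> -[].
have [a /eigenvalueP[x xA x0]] := sym_eigenvalue symA.
pose nx := Num.sqrt ((x *m x^T) 0 0).
have nx0 : 0 < nx by rewrite sqrtr_gt0 rV_sqr_gt0.
pose v := nx^-1 *: x.
have v1 : v *m v^T = 1%:M.
  rewrite /v linearZ /= -scalemxAl -scalemxAr scalerA [x *m _]mx11_scalar.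
  rewrite -[(x *m _) 0 0]sqr_sqrtr ?rV_sqr_ge0 // -/nx scale_scalar_mx.
  by congr _%:M; field; rewrite gt_eqF.
have vA : v *m A = a *: v by rewrite /v -scalemxAl xA !scalerA mulrC.
have [V [symV VV rowV]] := orthogonal_first_row v1.
pose B : 'M[R]_(1 + n) := V *m A *m V.
have symB : B^T = B by rewrite /B !trmx_mul symV symA mulmxA.
have rowB : row 0 B = a *: delta_mx 0 0.
  by rewrite /B !row_mul rowV vA -scalemxAl -rowV -row_mul VV row1.
pose B' := drsubmx B.
have BE : B = block_mx a%:M 0 0 B'.
  have ur0 : ursubmx B = 0.
    apply/matrixP => i j; rewrite !mxE ord1.
    have := congr1 (fun y : 'rV__ => y 0 (rshift 1 j)) rowB.
    rewrite !mxE => h; rewrite -[RHS](mulr0 a) -[in RHS](_ : (0 : R) = 0) //.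
    by rewrite [lshift _ _](_ : _ = 0) ?h; [rewrite -val_eqE | apply: val_inj].
  rewrite -[LHS]submxK ur0; congr block_mx.
    apply/matrixP => i j; rewrite !ord1 !mxE eqxx mulr1n.
    have := congr1 (fun y : 'rV__ => y 0 (lshift n 0)) rowB.
    rewrite !mxE => h.
    by rewrite [lshift _ _](_ : _ = 0) in h *; [rewrite h mulr1|apply: val_inj].
  by apply: trmx_inj; rewrite trmx_dlsub symB ur0 trmx0.
have symB' : B'^T = B' by rewrite /B' trmx_drsub symB.
have [U [d [UU dB]]] := IHn _ symB'.
pose W : 'M[R]_(1 + n) := block_mx 1%:M 0 0 U.
have WT : W^T = block_mx 1%:M 0 0 U^T by rewrite tr_block_mx !trmx0 trmx1.
have WW : W *m W^T = 1%:M.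
  rewrite WT mulmx_block !(mulmx0, mul0mx, addr0, add0r, mulmx1) UU.
  by rewrite -scalar_mx_block.
have BW : B = W *m diag_mx (row_mx a%:M d) *m W^T.
  rewrite BE dB WT diag_mx_row /W !mulmx_block.
  rewrite !(mulmx0, mul0mx, addr0, add0r, mulmx1, mul1mx).
  by congr block_mx; apply/matrixP => i j; rewrite !ord1 !mxE !mulr1n.
exists (V *m W), (row_mx a%:M d); split.
  by rewrite trmx_mul symV mulmxA -(mulmxA V W) WW mulmx1 VV.
have -> : A = V *m B *m V.
  by rewrite /B !mulmxA VV mul1mx -mulmxA VV mulmx1.
by rewrite BW trmx_mul symV !mulmxA.
Qed.

(** * Spectral form and the matrix exponential *)

(** With [W] orthogonal this is a spectral decomposition; with [W] merely
    invertible it is the congruence class of a diagonal quadratic form. *)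
Definition congr_diag (R : comPzRingType) n (W : 'M[R]_n) (d : 'rV[R]_n) : 'M[R]_n :=
  W *m diag_mx d *m W^T.

Section CongrDiag.
Variables (R : comPzRingType) (n : nat).
Implicit Types (U W V A B : 'M[R]_n) (d e : 'rV[R]_n).

Lemma congr_diag_sym W d : (congr_diag W d)^T = congr_diag W d.
Proof. by rewrite /congr_diag !trmx_mul trmxK tr_diag_mx mulmxA. Qed.

Lemma congr_diag_mul U d e : U^T *m U = 1%:M ->
  congr_diag U d *m congr_diag U e = congr_diag U (\row_j (d 0 j * e 0 j)).
Proof.
by move=> UU; rewrite /congr_diag !mulmxA -(mulmxA _ U^T) UU mulmx1
  -(mulmxA _ (diag_mx d)) mulmx_diag.
Qed.

Lemma congr_diagM V W d : V *m congr_diag W d *m V^T = congr_diag (V *m W) d.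
Proof. by rewrite /congr_diag trmx_mul !mulmxA. Qed.

Lemma congr_diagE W d i j :
  congr_diag W d i j = \sum_k d 0 k * (W i k * W j k).
Proof.
rewrite /congr_diag mul_mx_diag mxE; apply: eq_bigr => k _.
by rewrite !mxE; ring.
Qed.

Lemma congr_diag_const U (a : R) : U *m U^T = 1%:M ->
  congr_diag U (const_mx a) = a%:M.
Proof.
move=> UU; rewrite /congr_diag diag_const_mx mul_mx_scalar -scalemxAl UU.
by rewrite scale_scalar_mx mulr1.
Qed.

Lemma congr_diagZ W a d : congr_diag W (a *: d) = a *: congr_diag W d.
Proof. by rewrite /congr_diag linearZ /= -scalemxAr -scalemxAl. Qed.

Lemma congr_diagN W d : congr_diag W (- d) = - congr_diag W d.
Proof. by rewrite -scaleN1r congr_diagZ scaleN1r. Qed.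

Lemma congr_diagD W d e : congr_diag W (d + e) = congr_diag W d + congr_diag W e.
Proof. by rewrite /congr_diag linearD /= mulmxDr mulmxDl. Qed.

Lemma orthogonal_mul U V : U *m U^T = 1%:M -> V *m V^T = 1%:M ->
  (U *m V) *m (U *m V)^T = 1%:M.
Proof. by move=> UU VV; rewrite trmx_mul mulmxA -(mulmxA U) VV mulmx1. Qed.

(** The weights [(U^T *m V) i j ^+ 2] are the squared overlaps of the two
    eigenbases; they turn trace inequalities between non-commuting matrices into
    scalar inequalities between eigenvalues. *)
Lemma trace_congr_diag_mul U V d e :
  \tr (congr_diag U d *m congr_diag V e) =
  \sum_i \sum_j (U^T *m V) i j ^+ 2 * (d 0 i * e 0 j).
Proof.
have -> : \tr (congr_diag U d *m congr_diag V e)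
    = \tr (diag_mx d *m (U^T *m V) *m diag_mx e *m (U^T *m V)^T).
  rewrite /congr_diag -!mulmxA mxtrace_mulC !mulmxA trmx_mul trmxK.
  by rewrite !mulmxA.
rewrite /mxtrace; apply: eq_bigr => i _.
rewrite mxE; apply: eq_bigr => j _.
by rewrite mul_mx_diag mul_diag_mx !mxE; ring.
Qed.

End CongrDiag.

Lemma cvg_mxP (R : realType) m n (u : nat -> 'M[R]_(m, n)) (M : 'M[R]_(m, n)) :
  (forall i j, (u k i j @[k --> \oo] --> M i j)%classic) ->
  (u @ \oo --> M)%classic.
Proof.
move=> cu; apply/cvg_ballP => e e0.
have H i j := cvg_ball (cu i j) e0.
have : (\forall k \near \oo, forall ij : 'I_m * 'I_n,
    ball (M ij.1 ij.2) e (u k ij.1 ij.2))%classic.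
  by apply: filter_forall => -[i j]; exact: H.
by apply: filterS => k uk; split => // i j; exact: (uk (i, j)).
Qed.

Section ExpmxSpectral.
Variables (R : realType) (n : nat).
Implicit Types (U V L A : 'M[R]_n) (d e : 'rV[R]_n).

Lemma congr_diagX U d k : U *m U^T = 1%:M ->
  congr_diag U d ^+ k = congr_diag U (map_mx (fun x => x ^+ k) d).
Proof.
move=> UU; have UU' := mulmx1C UU; elim: k => [|k IHk].
  rewrite expr0 (_ : map_mx _ d = const_mx 1) ?congr_diag_const //.
  by apply/rowP => j; rewrite !mxE expr0.
rewrite exprS IHk -[LHS]/(_ *m _) congr_diag_mul //.
by congr congr_diag; apply/rowP => j; rewrite !mxE exprS.
Qed.

(** Entrywise, the partial sums of the exponential series are fixed linear
    combinations of the partial sums of the scalar series at the eigenvalues. *)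
Lemma expmx_congr_diag U d : U *m U^T = 1%:M ->
  expmx (congr_diag U d) = congr_diag U (map_mx expR d).
Proof.
move=> UU; rewrite /expmx; apply: cvg_lim; first exact: norm_hausdorff.
apply: cvg_mxP => i j; rewrite congr_diagE.
have -> : (fun k => series (fun k => k`!%:R^-1 *: congr_diag U d ^+ k) k i j)
  = (fun k => \sum_l series (exp_coeff (d 0 l)) k * (U i l * U j l)).
  apply/funext => k; rewrite /series /= summxE.
  under [RHS]eq_bigr do rewrite mulr_suml.
  rewrite exchange_big /=; apply: eq_bigr => p _.
  rewrite congr_diagX // mxE congr_diagE mulr_sumr.
  by apply: eq_bigr => l _; rewrite exp_coeffE mxE !mulrA.
apply: (cvg_big _ (op := +%R)) => [|l _]; first exact: add_continuous.
by rewrite mxE; apply: cvgMr_tmp; exact: is_cvg_series_exp_coeff.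
Qed.

End ExpmxSpectral.

(** * Scalar inequalities *)

Section ScalarInequalities.
Variable R : realType.
Implicit Types x y : R.

Lemma sinh_ge y : 0 <= y -> 2 * y <= expR y - expR (- y).
Proof.
rewrite le_eqVlt => /orP[/eqP <-|y0]; first by rewrite oppr0 subrr mulr0.
pose f (t : R) := expR t - expR (- t).
have df (t : R) : is_derive t 1 f (expR t + expR (- t)).
  rewrite /f; apply: is_derive_eq.
  by rewrite mulrN1 opprK.
have cf : {within `[0, y], continuous f}%classic.
  apply: continuous_subspaceT => t; apply: differentiable_continuous.
  by apply/derivable1_diffP; have [] := df t.
have [c _ fE] := MVT y0 (fun t _ => df t) cf.
move: fE; rewrite /f oppr0 subrr subr0 addr0 => ->; rewrite ler_pM2r //.
by have := expR_ge1Dx c; have := expR_ge1Dx (- c); lra.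
Qed.

(** Equivalently, the geometric mean of two positive numbers is at most their
    logarithmic mean. *)
Lemma sqr_le_cosh x : x ^+ 2 <= expR x + expR (- x) - 2.
Proof.
wlog x0 : x / 0 <= x.
  move=> H; have [/H //|xN] := leP 0 x.
  by have := H (- x); rewrite opprK sqrrN [expR x + _]addrC; apply; lra.
pose y := x / 2; have xE : x = y + y by rewrite /y; field.
have y0 : 0 <= y by rewrite /y; lra.
have := sinh_ge y0; set s := _ - _ => ys.
have -> : expR x + expR (- x) - 2 = s ^+ 2.
  have : expR y * expR (- y) = 1 by rewrite -expRD subrr expR0.
  by rewrite /s xE opprD !expRD; lra.
have -> : x ^+ 2 = (2 * y) ^+ 2 by rewrite xE; ring.
by rewrite lerXn2r // nnegrE ?(le_trans _ ys) //; lra.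
Qed.

Lemma cosh_le_sqr x : expR x + expR (- x) - 2 <= x ^+ 2 * expR `|x|.
Proof.
wlog x0 : x / 0 <= x.
  move=> H; have [/H //|xN] := leP 0 x.
  have := H (- x); rewrite opprK sqrrN normrN [expR x + _]addrC; apply; lra.
rewrite ger0_norm //; set e := expR x.
have e0 : 0 < e by exact: expR_gt0.
have eN : expR (- x) = e^-1 by rewrite expRN.
have e1 : e - 1 <= x * e.
  have := expR_ge1Dx (- x); rewrite eN => h.
  have : (1 - x) * e <= e^-1 * e by rewrite ler_pM2r.
  by rewrite mulVf ?gt_eqF //; lra.
have e2 : 0 <= e - 1 by have := expR_ge1Dx x; rewrite -/e; lra.
have -> : e + expR (- x) - 2 = (e - 1) ^+ 2 / e.
  by rewrite eN; field; rewrite gt_eqF.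
rewrite ler_pdivrMr //.
have -> : x ^+ 2 * e * e = (x * e) ^+ 2 by ring.
by rewrite lerXn2r // nnegrE // (le_trans e2).
Qed.

(** The passage to the limit in the number of subdivisions. *)
Lemma le_of_expR_scaled (a b c : R) : 0 <= a ->
  (forall N : nat, a <= expR (c / N.+1%:R) * b) -> a <= b.
Proof.
move=> a0 H; rewrite leNgt; apply/negP => ba.
have [N Nge] : exists N : nat, (a * c) / (a - b) < N.+1%:R.
  exists (Num.truncn (a * c / (a - b))); exact: truncnS_gt.
have := H N; set t := c / _ => /= ht.
have N0 : 0 < N.+1%:R :> R by [].
have : a * expR (- t) <= b.
  by rewrite expRN ler_pdivrMr ?expR_gt0 // mulrC.
have := expR_ge1Dx (- t) => h1 h2.
have : a * (1 - t) <= b by apply: le_trans h2; rewrite ler_wpM2l.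
apply/negP; rewrite -ltNge.
move: Nge; rewrite ltr_pdivrMr ?subr_gt0 // => Nge.
have : a * t < a - b by rewrite /t mulrA ltr_pdivrMr // [ltRHS]mulrC.
lra.
Qed.

Lemma sqr_sum_le N (u : nat -> R) :
  (\sum_(k < N) u k) ^+ 2 <= N%:R * \sum_(k < N) u k ^+ 2.
Proof.
elim: N => [|N IHN]; first by rewrite !big_ord0 expr0n /= mulr0.
have [->|N0] := posnP N; first by rewrite !big_ord1 mul1r.
rewrite !big_ord_recr /= -natr1.
set S := \sum_(k < N) u k in IHN *; set Q := \sum_(k < N) _ in IHN *.
have N0' : 0 < N%:R :> R by rewrite ltr0n.
have : 2 * (S * u N) <= Q + N%:R * u N ^+ 2.
  have h : 0 <= (S - N%:R * u N) ^+ 2 by exact: sqr_ge0.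
  rewrite -(ler_pM2l N0'); move: h; rewrite sqrrB; lra.
by rewrite sqrrD; lra.
Qed.
End ScalarInequalities.

(** * Exponentials of symmetric matrices and their comparison *)

Section ExpmxTheory.
Variables (R : realType) (n : nat).
Implicit Types (U V W X A G H L Y Z : 'M[R]_n) (d : 'rV[R]_n).

Lemma sym_congr_diag L : L^T = L ->
  exists U d, U *m U^T = 1%:M /\ L = congr_diag U d.
Proof. exact: spectral_theorem. Qed.

Lemma expmx_sym L : L^T = L -> (expmx L)^T = expmx L.
Proof.
by move=> /sym_congr_diag[U [d [UU ->]]]; rewrite expmx_congr_diag // congr_diag_sym.
Qed.

Lemma expmx_conj V L : V *m V^T = 1%:M -> L^T = L ->
  expmx (V *m L *m V^T) = V *m expmx L *m V^T.
Proof.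
move=> VV /sym_congr_diag[U [d [UU ->]]].
by rewrite congr_diagM !expmx_congr_diag ?congr_diagM //; exact: orthogonal_mul.
Qed.

Lemma expmxZD (a b : R) L : L^T = L ->
  expmx (a *: L) *m expmx (b *: L) = expmx ((a + b) *: L).
Proof.
move=> /sym_congr_diag[U [d [UU ->]]].
rewrite -!congr_diagZ !expmx_congr_diag // congr_diag_mul; last exact: mulmx1C.
by congr congr_diag; apply/rowP => j; rewrite !mxE -expRD -mulrDl.
Qed.

Lemma expmx_scalar (t : R) : expmx (t%:M : 'M[R]_n) = (expR t)%:M.
Proof.
have U1 : (1%:M : 'M[R]_n) *m 1%:M^T = 1%:M by rewrite trmx1 mulmx1.
rewrite -(congr_diag_const t U1) expmx_congr_diag // map_const_mx.
by rewrite congr_diag_const.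
Qed.

Lemma expmx0 : expmx (0 : 'M[R]_n) = 1%:M.
Proof.
have -> : 0 = 0%:M :> 'M[R]_n by rewrite raddf0.
by rewrite expmx_scalar expR0.
Qed.

Lemma expmxDscalar L (t : R) : L^T = L ->
  expmx (L + t%:M) = expR t *: expmx L.
Proof.
move=> /sym_congr_diag[U [d [UU ->]]].
rewrite -(congr_diag_const t UU) -congr_diagD !expmx_congr_diag // -congr_diagZ.
by congr congr_diag; apply/rowP => j; rewrite !mxE addrC expRD.
Qed.

Lemma expmxNr L : L^T = L -> expmx L *m expmx (- L) = 1%:M.
Proof.
by move=> sL; rewrite -[L]scale1r -scaleNr expmxZD // subrr scale0r expmx0.
Qed.

Lemma expmx_unit L : L^T = L -> expmx L \in unitmx.
Proof. by move=> /expmxNr /mulmx1_unit[]. Qed.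

Lemma expmxN L : L^T = L -> expmx (- L) = invmx (expmx L).
Proof.
move=> sL; rewrite -[RHS]mulmx1 -(expmxNr sL) mulmxA mulVmx ?mul1mx //.
exact: expmx_unit.
Qed.

Lemma expmx_half L : L^T = L ->
  expmx (2^-1 *: L) *m expmx (2^-1 *: L) = expmx L.
Proof. by move=> sL; rewrite expmxZD // -[2^-1]div1r -splitr scale1r. Qed.

Lemma sym_scale (a : R) L : L^T = L -> (a *: L)^T = a *: L.
Proof. by move=> sL; rewrite linearZ /= sL. Qed.

Lemma sym_congr X L : L^T = L -> (X *m L *m X^T)^T = X *m L *m X^T.
Proof. by move=> sL; rewrite !trmx_mul trmxK sL mulmxA. Qed.

Lemma spd_gram X : X \in unitmx -> spd (X *m X^T).
Proof.
move=> uX; split; first by rewrite trmx_mul trmxK.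
move=> v v0; have w0 : v^T *m X != 0.
  apply: contraNneq v0 => /(canRL (mulmxK uX)); rewrite mul0mx.
  by move=> /(canRL (@trmxK _ _ _)) ->; rewrite trmx0.
have -> : v^T *m (X *m X^T) *m v = (v^T *m X) *m (v^T *m X)^T.
  by rewrite trmx_mul trmxK !mulmxA.
by rewrite rV_sqr_gt0.
Qed.

Lemma spd1 : spd (1%:M : 'M[R]_n).
Proof. by have := spd_gram (unitmx1 R n); rewrite trmx1 mulmx1. Qed.

Lemma spd_expmx L : L^T = L -> spd (expmx L).
Proof.
move=> sL; have sh := sym_scale 2^-1 sL.
rewrite -expmx_half // -[in X in _ *m X](expmx_sym sh).
exact/spd_gram/expmx_unit.
Qed.

Lemma spd_expmxP A : spd A -> exists2 L, L^T = L & A = expmx L.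
Proof.
move=> [sA pA]; have [U [d [UU AE]]] := sym_congr_diag sA.
have d0 j : 0 < d 0 j.
  have := pA (col j U); rewrite AE.
  have -> : (col j U)^T *m congr_diag U d *m col j U = (d 0 j)%:M.
    have UU' := mulmx1C UU.
    rewrite colE trmx_mul /congr_diag !mulmxA -(mulmxA _ U^T U) UU' mulmx1.
    rewrite -(mulmxA _ U^T U) UU' mulmx1 trmx_delta -rowE row_diag_mx -scalemxAl.
    rewrite mul_delta_mx; apply/matrixP=> i k.
    by rewrite !ord1 !mxE !eqxx /= mulr1n mulr1.
  rewrite mxE mulr1n; apply.
  apply: contra_eqN UU => /eqP Uj0; apply/eqP => /mulmx1C/matrixP/(_ j j).
  rewrite !mxE eqxx big1 => [/esym/eqP|k _]; first by rewrite oner_eq0.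
  have := congr1 (fun M : 'cV__ => M k 0) Uj0.
  by rewrite !mxE => ->; rewrite mulr0.
exists (congr_diag U (map_mx (@ln R) d)); first exact: congr_diag_sym.
rewrite AE expmx_congr_diag //; congr congr_diag.
by apply/rowP => j; rewrite !mxE lnK // posrE.
Qed.

Lemma spd_congr X A : X \in unitmx -> spd A -> spd (X *m A *m X^T).
Proof.
move=> uX /spd_expmxP[L sL ->]; have sh := sym_scale 2^-1 sL.
have := spd_gram (X := X *m expmx (2^-1 *: L)).
rewrite trmx_mul expmx_sym // mulmxA -(mulmxA X) expmx_half //; apply.
by rewrite unitmx_mul uX expmx_unit.
Qed.

(** The local form of the exponential metric increasing property. In the mixed
    eigenbases of [L] and [Y] with overlaps [o] and eigenvalues [d], [e], the left
    side is the sum of [o ^+ 2 * (e - d) ^+ 2] and the right side that of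
    [o ^+ 2 * (expR (e - d) + expR (d - e) - 2)]. The right side depends only on
    the spectrum of [expmx (- L) *m expmx Y], hence is invariant under congruence. *)
Lemma log_dist_le_trace L Y : L^T = L -> Y^T = Y ->
  \tr ((Y - L) *m (Y - L)) <=
  \tr (expmx (- L) *m expmx Y) + \tr (expmx L *m expmx (- Y)) - n%:R *+ 2.
Proof.
move=> /sym_congr_diag[U [d [UU ->]]] /sym_congr_diag[V [e [VV ->]]].
have UU' := mulmx1C UU; have VV' := mulmx1C VV.
have sq W f : W^T *m W = 1%:M ->
    congr_diag W f *m congr_diag W f = congr_diag W (\row_j f 0 j ^+ 2).
  by move=> WW; rewrite congr_diag_mul //; congr congr_diag.
have tr1 : n%:R = \tr (congr_diag U (const_mx 1) *m congr_diag V (const_mx 1)).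
  by rewrite !congr_diag_const // mulmx1 mxtrace1.
have sqU : \tr (congr_diag U d *m congr_diag U d) =
    \tr (congr_diag U (\row_j d 0 j ^+ 2) *m congr_diag V (const_mx 1)).
  by rewrite sq // congr_diag_const // mulmx1.
have sqV : \tr (congr_diag V e *m congr_diag V e) =
    \tr (congr_diag U (const_mx 1) *m congr_diag V (\row_j e 0 j ^+ 2)).
  by rewrite sq // congr_diag_const // mul1mx.
rewrite mulmxBl !mulmxBr !linearB /=.
rewrite [\tr (congr_diag V e *m congr_diag U d)]mxtrace_mulC.
rewrite sqU sqV tr1 -!congr_diagN !expmx_congr_diag //.
rewrite !trace_congr_diag_mul opprK [- \sum_i _ + _]addrC.
rewrite -!sumrB -sumrMnl -!big_split /= -sumrB.
apply: ler_sum => i _; rewrite -!sumrB -sumrMnl -!big_split /= -sumrB.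
apply: ler_sum => j _; rewrite !mxE -!expRD.
set o := _ ^+ 2; have o0 : 0 <= o by exact: sqr_ge0.
have := sqr_le_cosh (e 0 j - d 0 i); rewrite opprB [- d 0 i + _]addrC.
move=> /(ler_wpM2l o0); lra.
Qed.

Lemma trace_sqrE A : A^T = A -> \tr (A *m A) = \sum_i \sum_j A i j ^+ 2.
Proof.
move=> sA; rewrite -{2}sA /mxtrace; apply: eq_bigr => i _.
by rewrite mxE; apply: eq_bigr => j _; rewrite mxE expr2.
Qed.

Lemma trace_sqr_ge0 A : A^T = A -> 0 <= \tr (A *m A).
Proof.
move=> sA; rewrite trace_sqrE // sumr_ge0 // => i _.
by rewrite sumr_ge0 // => j _; exact: sqr_ge0.
Qed.

Lemma trace_sqr_eq0 A : A^T = A -> \tr (A *m A) <= 0 -> A = 0.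
Proof.
move=> sA; rewrite trace_sqrE // => h; apply/matrixP => i j; rewrite mxE.
apply/eqP; rewrite -sqrf_eq0 eq_le sqr_ge0 andbT; apply: le_trans h.
have nn k : 0 <= \sum_l A k l ^+ 2 by rewrite sumr_ge0 // => l _; exact: sqr_ge0.
rewrite (bigD1 i) //= (bigD1 j) //= -addrA lerDl addr_ge0 ?sumr_ge0 // => l _.
exact: sqr_ge0.
Qed.

(** The local inequality with a vanishing right side. *)
Lemma expmx_inj L Y : L^T = L -> Y^T = Y -> expmx L = expmx Y -> L = Y.
Proof.
move=> sL sY LY; apply/eqP; rewrite eq_sym -subr_eq0; apply/eqP.
apply: trace_sqr_eq0; first by rewrite linearB /= sL sY.
apply: le_trans (log_dist_le_trace sL sY) _.
have eVe Z : Z^T = Z -> expmx (- Z) *m expmx Z = 1%:M.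
  by move=> /expmxNr/mulmx1C.
by rewrite -LY eVe // LY expmxNr // mxtrace1 -mulr2n subrr.
Qed.

End ExpmxTheory.

(** * The affine-invariant distance and projections *)

Section AffineInvariantDistance.
Variables (R : realType) (n : nat).
Implicit Types (U V W X S A G H L Y Z : 'M[R]_n) (d : 'rV[R]_n).

(** The congruence invariance of the bound of [log_dist_le_trace], for two points of
    one geodesic. *)
Lemma trace_pencil X Z (a b : R) L Y : X \in unitmx -> Z^T = Z -> L^T = L ->
  expmx L = X *m expmx (a *: Z) *m X^T ->
  expmx Y = X *m expmx (b *: Z) *m X^T ->
  \tr (expmx (- L) *m expmx Y) = \tr (expmx ((b - a) *: Z)).
Proof.
move=> uX sZ sL EL EY; have uXT : X^T \in unitmx by rewrite unitmx_tr.
pose M := invmx X^T *m expmx (- a *: Z) *m invmx X.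
have LM : expmx L *m M = 1%:M.
  rewrite EL /M !mulmxA mulmxK // -(mulmxA X) expmxZD // subrr scale0r.
  by rewrite expmx0 mulmx1 mulmxV.
have -> : expmx (- L) = M.
  by rewrite -[LHS]mulmx1 -LM mulmxA (mulmx1C (expmxNr sL)) mul1mx.
rewrite EY /M !mulmxA mulmxKV // -(mulmxA (invmx _)) expmxZD //.
by rewrite mxtrace_mulC mulmxA mulmxV // mul1mx addrC.
Qed.

(** The exponential metric increasing property: the straight-line distance of two
    logarithms is at most the affine-invariant distance, here the norm of [Z].
    Cut the geodesic [X *m expmx (t *: Z) *m X^T] into [N.+1] equal pieces and apply
    [log_dist_le_trace] to each: by congruence invariance every piece contributes
    the same bound, which is [\tr (Z *m Z) / N.+1 ^+ 2] up to a factor tending to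
    one, and the pieces add up by Cauchy-Schwarz. *)
Theorem exp_metric_increasing X L Y Z : X \in unitmx ->
  L^T = L -> Y^T = Y -> Z^T = Z ->
  expmx L = X *m X^T -> expmx Y = X *m expmx Z *m X^T ->
  \tr ((Y - L) *m (Y - L)) <= \tr (Z *m Z).
Proof.
move=> uX sL sY sZ EL EY.
have [U [z [UU Zz]]] := sym_congr_diag sZ.
have trZ : \tr (Z *m Z) = \sum_i z 0 i ^+ 2.
  rewrite {}Zz congr_diag_mul ?(mulmx1C UU) // /congr_diag mxtrace_mulC mulmxA.
  by rewrite (mulmx1C UU) mul1mx mxtrace_diag; apply: eq_bigr => i _; rewrite mxE.
have sDYL : (Y - L)^T = Y - L by rewrite linearB /= sL sY.
apply: (@le_of_expR_scaled _ _ _ (\sum_i `|z 0 i|)) => [|N].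
  exact: trace_sqr_ge0.
set h : R := N.+1%:R; have h0 : 0 < h by rewrite ltr0n.
(* [K k] is the logarithm of the [k]-th subdivision point of the geodesic. *)
have /choice[K HK] : forall k : nat, exists K : 'M[R]_n,
    K^T = K /\ expmx K = X *m expmx ((k%:R / h) *: Z) *m X^T.
  move=> k; have := spd_congr uX (spd_expmx (sym_scale (k%:R / h) sZ)).
  by move=> /spd_expmxP[K sK ->]; exists K.
have K0 : K 0%N = L.
  have [sK EK] := HK 0%N; apply: expmx_inj => //.
  by rewrite EK mul0r scale0r expmx0 mulmx1.
have KN : K N.+1 = Y.
  have [sK EK] := HK N.+1; apply: expmx_inj => //.
  by rewrite EK divff ?gt_eqF // scale1r.
have step k : \tr ((K k.+1 - K k) *m (K k.+1 - K k)) <=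
    expR ((\sum_i `|z 0 i|) / h) * (\sum_i z 0 i ^+ 2) / h ^+ 2.
  have [[sK EK] [sK' EK']] := (HK k, HK k.+1).
  apply: le_trans (log_dist_le_trace sK sK') _.
  rewrite (trace_pencil uX sZ sK EK EK').
  rewrite [\tr (expmx (K k) *m _)]mxtrace_mulC (trace_pencil uX sZ sK' EK' EK).
  rewrite -[_ / h - k%:R / h]mulrBl -[k%:R / h - _]mulrBl.
  rewrite -natr1 opprD !addrA subrr add0r [_ + _ - k%:R]addrC addrA addNr add0r.
  rewrite Zz -!congr_diagZ !expmx_congr_diag //.
  have tr_cd f : \tr (congr_diag U f) = \sum_i f 0 i.
    by rewrite /congr_diag mxtrace_mulC mulmxA (mulmx1C UU) mul1mx mxtrace_diag.
  rewrite !tr_cd -big_split /= [n%:R](_ : _ = \sum_(i < n) 1); last first.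
    by rewrite sumr_const card_ord.
  rewrite -sumrMnl -sumrB mulr_sumr mulr_suml; apply: ler_sum => i _.
  rewrite !mxE; set t := z 0 i / h.
  rewrite mulN1r mulNr mul1r ![h^-1 * _]mulrC -/t.
  apply: le_trans (cosh_le_sqr t) _.
  rewrite mulrC -mulrA [_ ^+ 2 / _](_ : _ = t ^+ 2); last first.
    by rewrite /t expr_div_n.
  apply: ler_wpM2r; first exact: sqr_ge0.
  rewrite ler_expR /t normrM normfV (gtr0_norm h0) ler_pM2r ?invr_gt0 //.
  by rewrite (bigD1 i) //= lerDl sumr_ge0.
have YLE : Y - L = \sum_(k < N.+1) (K k.+1 - K k).
  by rewrite -(big_mkord xpredT (fun k => K k.+1 - K k)) telescope_sumr // KN K0.
rewrite trace_sqrE // trZ.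
have sK k : (K k.+1 - K k)^T = K k.+1 - K k.
  by rewrite linearB /= (HK k).1 (HK k.+1).1.
apply: (@le_trans _ _
    (h * \sum_(k < N.+1) \tr ((K k.+1 - K k) *m (K k.+1 - K k)))).
  under [X in _ <= _ * X]eq_bigr do rewrite trace_sqrE //.
  rewrite [X in _ <= _ * X]exchange_big mulr_sumr; apply: ler_sum => i _.
  rewrite [X in _ <= _ * X]exchange_big mulr_sumr; apply: ler_sum => j _.
  by rewrite YLE summxE; exact: (sqr_sum_le _ (fun k => (K k.+1 - K k) i j)).
apply: (@le_trans _ _ (h * \sum_(k < N.+1)
    (expR ((\sum_i `|z 0 i|) / h) * (\sum_i z 0 i ^+ 2) / h ^+ 2))).
  by apply: ler_wpM2l; [exact: ltW | apply: ler_sum => k _; exact: step].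
rewrite sumr_const card_ord -mulr_natl -/h le_eqVlt.
apply/orP; left; apply/eqP.
by field; rewrite gt_eqF.
Qed.

Lemma logmx_expmx L : L^T = L -> logmx (expmx L) = L.
Proof.
by move=> sL; apply: get_unique => // Y [sY EY]; exact: expmx_inj.
Qed.

Lemma spd_sqrt_unique S L : L^T = L -> spd S -> S *m S = expmx L ->
  S = expmx (2^-1 *: L).
Proof.
move=> sL /spd_expmxP[K sK ->]; rewrite -[K]scale1r expmxZD // => EK.
have sK2 : (1 + 1) *: K = L by apply: expmx_inj => //; exact: sym_scale.
by rewrite -sK2 scalerA mulVf // (_ : 1 + 1 = 2) // pnatr_eq0.
Qed.

Lemma sqrtmx_expmx L : L^T = L -> sqrtmx (expmx L) = expmx (2^-1 *: L).
Proof.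
move=> sL; apply: get_unique => [|S [pS SS]]; last exact: spd_sqrt_unique.
by split; [exact/spd_expmx/sym_scale | exact: expmx_half].
Qed.

Lemma frobenius_sym A : A^T = A -> frobenius A = Num.sqrt (\tr (A *m A)).
Proof.
by move=> sA; rewrite /frobenius trace_sqrE.
Qed.

(** Any factor [X] of [H] may replace its square root: the two differ by an
    orthogonal matrix, which conjugates the logarithm. *)
Lemma dAI_expmx X Z H G : X \in unitmx -> Z^T = Z ->
  H = X *m X^T -> G = X *m expmx Z *m X^T ->
  dAI H G = Num.sqrt (\tr (Z *m Z)).
Proof.
move=> uX sZ HE GE.
have [L sL EL] : exists2 L, L^T = L & H = expmx L.
  by apply: spd_expmxP; rewrite HE; exact: spd_gram.
have sL2 := sym_scale 2^-1 sL.
rewrite /dAI EL sqrtmx_expmx // -expmxN //; set T := expmx _.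
have sT : T^T = T by apply: expmx_sym; rewrite linearN /= sL2.
have [V VE] : exists V, V = T *m X by exists (T *m X).
have VV : V *m V^T = 1%:M.
  rewrite VE trmx_mul sT !mulmxA -(mulmxA T) -HE EL -(expmx_half sL) /T.
  by rewrite !mulmxA (mulmx1C (expmxNr sL2)) mul1mx expmxNr.
have -> : T *m G *m T = V *m expmx Z *m V^T.
  by rewrite VE trmx_mul sT GE !mulmxA.
rewrite -expmx_conj // logmx_expmx; last exact: sym_congr.
rewrite frobenius_sym; last exact: sym_congr.
have VV' := mulmx1C VV; congr Num.sqrt.
rewrite !mulmxA -(mulmxA _ V^T V) VV' mulmx1 mxtrace_mulC !mulmxA.
by rewrite VV' mul1mx.
Qed.

(** In the frame [S] where the candidate projection becomes the identity, the
    exponential metric increasing property gives the Pythagorean inequality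
    [dAI H G ^+ 2 >= |L| ^+ 2 + |Y| ^+ 2] as soon as [L] is orthogonal to [Y]; so
    orthogonality of [L] to all logarithms of the family yields at once that
    [S *m S^T] is a minimizer and that it is the only one. *)
Lemma proj_of_orthogonal_log (K : set 'M[R]_n) S L H :
  S \in unitmx -> L^T = L -> H = S *m expmx L *m S^T -> K (S *m S^T) ->
  (forall G, K G -> exists Y, [/\ Y^T = Y, G = S *m expmx Y *m S^T
     & \tr (L *m Y) = 0]) ->
  unique (is_argmin K (dAI H)) (S *m S^T).
Proof.
move=> uS sL HE KS KG; have sL2 := sym_scale 2^-1 sL.
pose X := S *m expmx (2^-1 *: L).
have XT : X^T = expmx (2^-1 *: L) *m S^T by rewrite trmx_mul expmx_sym.
have uX : X \in unitmx by rewrite unitmx_mul uS expmx_unit.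
have HX : H = X *m X^T by rewrite XT /X mulmxA -(mulmxA S) expmx_half.
have sNL : (- L)^T = - L by rewrite linearN /= sL.
have PX : S *m S^T = X *m expmx (- L) *m X^T.
  rewrite XT /X -!mulmxA (mulmxA (expmx (- L))) -[- L]scaleN1r expmxZD //.
  rewrite (mulmxA (expmx (_ *: L))) expmxZD // (_ : _ + _ = 0); last by field.
  by rewrite scale0r expmx0 mul1mx.
have dP : dAI H (S *m S^T) = Num.sqrt (\tr (L *m L)).
  by rewrite (dAI_expmx uX sNL HX PX) mulmxN mulNmx opprK.
have dG G : K G -> exists Y, [/\ Y^T = Y, G = S *m expmx Y *m S^T &
    Num.sqrt (\tr (L *m L) + \tr (Y *m Y)) <= dAI H G].
  move=> /KG[Y [sY GE LY]]; exists Y; split=> //.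
  pose T := expmx (- (2^-1 *: L)).
  have sT : T^T = T by apply: expmx_sym; rewrite linearN /= sL2.
  have uT : T \in unitmx by apply: expmx_unit; rewrite linearN /= sL2.
  have [Z sZ EZ] : exists2 Z, Z^T = Z & T *m expmx Y *m T = expmx Z.
    have := spd_congr uT (spd_expmx sY); rewrite sT.
    by move=> /spd_expmxP[Z sZ ->]; exists Z.
  have YE : expmx Y = expmx (2^-1 *: L) *m expmx Z *m expmx (2^-1 *: L)^T.
    rewrite -EZ linearZ /= sL !mulmxA expmxNr // mul1mx -mulmxA.
    by rewrite (mulmx1C (expmxNr sL2)) mulmx1.
  have GX : G = X *m expmx Z *m X^T.
    by rewrite XT GE YE linearZ /= sL /X !mulmxA.
  rewrite (dAI_expmx uX sZ HX GX) ler_sqrt ?trace_sqr_ge0 //.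
  apply: le_trans (exp_metric_increasing (expmx_unit sL2) sL sY sZ _ _);
    last 2 first.
  - by rewrite expmx_sym // expmx_half.
  - by rewrite YE linearZ /= sL expmx_sym.
  rewrite mulmxBl !mulmxBr !linearB /= [\tr (Y *m L)]mxtrace_mulC LY.
  lra.
split; first split=> // G /dG[Y [sY _ le_dG]].
  apply: le_trans le_dG; rewrite dP ler_sqrt ?addr_ge0 ?trace_sqr_ge0 //.
  by rewrite lerDl trace_sqr_ge0.
move=> G [/dG[Y [sY GE le_dG]] /(_ _ KS) le_GP].
have := le_trans le_dG le_GP; rewrite dP ler_sqrt ?trace_sqr_ge0 // gerDl => Y0.
by rewrite GE (trace_sqr_eq0 sY Y0) expmx0 mulmx1.
Qed.

End AffineInvariantDistance.

(** * Quadratic forms and generalized eigenvalues *)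

Section QuadraticForms.
Variables (R : realType) (n : nat).
Implicit Types (W A G H L S : 'M[R]_n) (d : 'rV[R]_n) (x y v : 'cV[R]_n).

Definition qform A x y : R := (x^T *m A *m y) 0 0.

Lemma qformC A x y : A^T = A -> qform A x y = qform A y x.
Proof.
move=> sA; rewrite /qform.
have -> : y^T *m A *m x = (x^T *m A *m y)^T by rewrite !trmx_mul trmxK sA mulmxA.
by rewrite [in RHS]mxE.
Qed.

Lemma qformDl A x y z : qform A (x + y) z = qform A x z + qform A y z.
Proof. by rewrite /qform linearD /= !mulmxDl mxE. Qed.

Lemma qformDr A x y z : qform A x (y + z) = qform A x y + qform A x z.
Proof. by rewrite /qform mulmxDr mxE. Qed.

Lemma qformZl A a x y : qform A (a *: x) y = a * qform A x y.
Proof. by rewrite /qform linearZ /= -!scalemxAl mxE. Qed.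

Lemma qformZr A a x y : qform A x (a *: y) = a * qform A x y.
Proof. by rewrite /qform -scalemxAr mxE. Qed.

Lemma qform_congr S A x y :
  qform (S *m A *m S^T) x y = qform A (S^T *m x) (S^T *m y).
Proof. by rewrite /qform trmx_mul trmxK !mulmxA. Qed.

Lemma qform_diag d x : qform (diag_mx d) x x = \sum_i d 0 i * x i 0 ^+ 2.
Proof.
rewrite /qform mul_mx_diag mxE; apply: eq_bigr => i _.
by rewrite !mxE; ring.
Qed.

Lemma qform1 x : qform 1%:M x x = \sum_i x i 0 ^+ 2.
Proof.
rewrite -diag_const_mx qform_diag; apply: eq_bigr => i _.
by rewrite mxE mul1r.
Qed.

Lemma qform_delta A i : qform A (delta_mx i 0) (delta_mx i 0) = A i i.
Proof. by rewrite /qform trmx_delta -rowE -colE !mxE. Qed.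

Lemma delta_col_neq0 i : delta_mx i 0 != 0 :> 'cV[R]_n.
Proof.
by apply/eqP => /matrixP/(_ i 0)/eqP; rewrite !mxE !eqxx oner_eq0.
Qed.

Lemma col_neq0P v : v != 0 -> exists j, v j 0 != 0.
Proof.
move=> v0; apply/existsP; apply: contraNT v0 => /existsPn v0; apply/eqP/colP => j.
by rewrite mxE; apply/eqP; have := v0 j; rewrite negbK.
Qed.

Lemma spd_diag_gt0 A i : spd A -> 0 < A i i.
Proof. by move=> pA; rewrite -qform_delta; exact: (pA.2 _ (delta_col_neq0 i)). Qed.

Lemma spd_ge0 A x : spd A -> 0 <= qform A x x.
Proof.
move=> [_ pA]; have [->|/pA/ltW//] := eqVneq x 0.
by rewrite /qform mulmx0 mxE.
Qed.

Lemma qform_cauchy_schwarz A x y : spd A ->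
  qform A x y ^+ 2 <= qform A x x * qform A y y.
Proof.
move=> sA; have [y0|] := eqVneq y 0.
  by rewrite y0 /qform !mulmx0 !mxE mulr0 expr0n.
move=> /sA.2; rewrite -/(qform A y y) => yy.
have := spd_ge0 (qform A y y *: x - qform A x y *: y) sA.
rewrite -scaleNr !(qformDl, qformDr, qformZl, qformZr) (qformC y x sA.1) => h.
rewrite -subr_ge0 -(pmulr_rge0 _ yy); apply: le_trans h _.
by rewrite le_eqVlt; apply/orP; left; apply/eqP; ring.
Qed.

Lemma spd_congr_diag W d : W \in unitmx -> (forall i, 0 < d 0 i) ->
  spd (congr_diag W d).
Proof.
move=> uW d0.
have U1 : (1%:M : 'M[R]_n) *m 1%:M^T = 1%:M by rewrite trmx1 mulmx1.
rewrite -[W]mulmx1 -congr_diagM.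
suff -> : d = map_mx expR (map_mx (@ln R) d).
  by rewrite -expmx_congr_diag //; apply/spd_congr/spd_expmx/congr_diag_sym.
by apply/rowP => j; rewrite !mxE lnK // posrE.
Qed.

Lemma simultaneous_diag G H : spd G -> H^T = H ->
  exists W d, [/\ W \in unitmx, G = W *m W^T & H = congr_diag W d].
Proof.
move=> /spd_expmxP[L sL ->] sH; have sL2 := sym_scale 2^-1 sL.
have sNL2 : (- (2^-1 *: L))^T = - (2^-1 *: L) by rewrite linearN /= sL2.
pose T := expmx (- (2^-1 *: L)); pose S := expmx (2^-1 *: L).
have ST : S *m T = 1%:M by exact: expmxNr.
have TS : T *m S = 1%:M by exact: mulmx1C.
have sT : T^T = T by exact: expmx_sym.
have sS : S^T = S by exact: expmx_sym.
have [U [d [UU E]]] : exists U d,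
    U *m U^T = 1%:M /\ T *m H *m T^T = congr_diag U d.
  by apply: sym_congr_diag; exact: sym_congr.
exists (S *m U), d; split.
- by rewrite unitmx_mul expmx_unit //; have [] := mulmx1_unit UU.
- by rewrite trmx_mul mulmxA -(mulmxA S) UU mulmx1 sS expmx_half.
- by rewrite -congr_diagM -E sT sS !mulmxA ST mul1mx -mulmxA TS mulmx1.
Qed.

Lemma gen_eigenvalues_congr S G H : S \in unitmx ->
  gen_eigenvalues (S *m G *m S^T) (S *m H *m S^T) = gen_eigenvalues G H.
Proof.
move=> uS; have uST : S^T \in unitmx by rewrite unitmx_tr.
apply/seteqP; split => a /= [v v0 E].
  exists (S^T *m v).
    by apply: contraNneq v0 => /(canRL (mulKmx uST)) ->; rewrite mulmx0.
  by apply: (can_inj (mulKmx uS)); rewrite -scalemxAr !mulmxA.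
exists (invmx S^T *m v).
  by apply: contraNneq v0 => /(canRL (mulKVmx uST)) ->; rewrite mulmx0.
by rewrite -!(mulmxA _ S^T) mulKVmx // -!mulmxA E -scalemxAr.
Qed.

Lemma kappa_congr S G H : S \in unitmx ->
  kappa (S *m G *m S^T) (S *m H *m S^T) = kappa G H.
Proof. by move=> uS; rewrite /kappa gen_eigenvalues_congr. Qed.

Lemma gen_eigenvalue_diag g d a :
  gen_eigenvalues (diag_mx g) (diag_mx d) a -> exists j, d 0 j = a * g 0 j.
Proof.
move=> [v /col_neq0P[j vj] E]; exists j; have := congr1 (fun x : 'cV__ => x j 0) E.
by rewrite !mul_diag_mx !mxE mulrA => /(mulIf vj).
Qed.

Lemma gen_eigenvalues_diag d :
  gen_eigenvalues 1%:M (diag_mx d) = [set a | exists j, a = d 0 j]%classic.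
Proof.
apply/seteqP; split => a /=.
  rewrite -diag_const_mx => /gen_eigenvalue_diag[j].
  by rewrite mxE mulr1 => dj; exists j.
move=> [j ->]; exists (delta_mx j 0).
  exact: delta_col_neq0.
rewrite mul1mx mul_diag_mx; apply/colP => i; rewrite !mxE eqxx andbT.
by case: eqP => [->//|_]; rewrite !mulr0.
Qed.

End QuadraticForms.

(** The generalized eigenvalues are the diagonal entries of [H] in a basis that
    is orthonormal for [G], so their extreme values are attained and bound the
    Rayleigh quotient. *)
Lemma kappa_extremes (R : realType) n (G H : 'M[R]_n.+1) : spd G -> spd H ->
  exists a b : R, [/\ 0 < b, kappa G H = a / b,
    gen_eigenvalues G H a, gen_eigenvalues G H b &
    forall x, b * qform G x x <= qform H x x <= a * qform G x x].
Proof.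
move=> pG pH; have [W [d [uW GE HE]]] := simultaneous_diag pG pH.1.
have G1 : G = W *m 1%:M *m W^T by rewrite mulmx1.
have gE : gen_eigenvalues G H = [set a | exists j, a = d 0 j]%classic.
  by rewrite -gen_eigenvalues_diag G1 HE gen_eigenvalues_congr.
have [i0 _ i0P] := arg_maxP (fun i => d 0 i) (erefl : xpredT (0 : 'I_n.+1)).
have [i1 _ i1P] := arg_minP (fun i => d 0 i) (erefl : xpredT (0 : 'I_n.+1)).
have d0 : 0 < d 0 i1.
  have uWT : W^T \in unitmx by rewrite unitmx_tr.
  pose e : 'cV[R]_n.+1 := delta_mx i1 0.
  have e0 : e != 0 by exact: delta_col_neq0.
  have v0 : invmx W^T *m e != 0.
    by apply: contraNneq e0 => /(canRL (mulKVmx uWT)) ->; rewrite mulmx0.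
  have := pH.2 _ v0; rewrite -/(qform _ _ _) HE /congr_diag qform_congr mulKVmx //.
  by rewrite qform_delta mxE eqxx mulr1n.
exists (d 0 i0), (d 0 i1); split => //.
- rewrite /kappa gE; congr (_ / _); apply/eqP; rewrite eq_le; apply/andP; split.
  + by apply: ge_sup => [|_ [j ->]]; [exists (d 0 i0), i0 | exact: i0P].
  + by apply: ub_le_sup; [exists (d 0 i0) => _ [j ->]; exact: i0P | exists i0].
  + by apply: ge_inf; [exists (d 0 i1) => _ [j ->]; exact: i1P | exists i1].
  + by apply: lb_le_inf => [|_ [j ->]]; [exists (d 0 i0), i0 | exact: i1P].
- by rewrite gE; exists i0.
- by rewrite gE; exists i1.
- move=> x; rewrite G1 HE /congr_diag !qform_congr.
  rewrite qform1 qform_diag !mulr_sumr; apply/andP; split; apply: ler_sum => i _.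
  + by rewrite ler_wpM2r ?sqr_ge0 //; exact: i1P.
  + by rewrite ler_wpM2r ?sqr_ge0 //; exact: i0P.
Qed.

(** * Kronecker products and the determinant form *)

Section Tensor.
Variable R : realType.

Lemma tensmx1 m n : (1%:M : 'M[R]_m) *t (1%:M : 'M[R]_n) = 1%:M.
Proof.
apply/matrixP => k l.
case: (mxtens_indexP k) => i j; case: (mxtens_indexP l) => p q.
rewrite tensmxE !mxE (can_eq (@mxtens_indexK _ _)) xpair_eqE.
by do 2 case: eqP => _; rewrite /= ?mulr0 ?mul0r ?mulr1.
Qed.

Lemma tensmxZl m n p q a (A : 'M[R]_(m, n)) (C : 'M[R]_(p, q)) :
  (a *: A) *t C = a *: (A *t C).
Proof. by apply/matrixP => i j; rewrite !mxE mulrA. Qed.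

Lemma tensmxZr m n p q a (A : 'M[R]_(m, n)) (C : 'M[R]_(p, q)) :
  A *t (a *: C) = a *: (A *t C).
Proof. by apply/matrixP => i j; rewrite !mxE mulrCA. Qed.

Lemma mxtrace_tens m n (A : 'M[R]_m) (B : 'M[R]_n) :
  \tr (A *t B) = \tr A * \tr B.
Proof. by rewrite /mxtrace mulr_sum; apply: eq_bigr => i _; rewrite mxE. Qed.

Lemma tens_diag_mx m n (d : 'rV[R]_m) (e : 'rV[R]_n) :
  diag_mx d *t diag_mx e =
  diag_mx (\row_k (d 0 (mxtens_unindex k).1 * e 0 (mxtens_unindex k).2)).
Proof.
apply/matrixP => k l.
case: (mxtens_indexP k) => i j; case: (mxtens_indexP l) => p q.
rewrite tensmxE !mxE mxtens_indexK (can_eq (@mxtens_indexK _ _)) xpair_eqE /=.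
by do 2 case: eqP => _; rewrite /= ?mulr0n ?mulr1n ?mulr0 ?mul0r.
Qed.

Lemma tens_congr_diag m n (U : 'M[R]_m) (V : 'M[R]_n) d e :
  congr_diag U d *t congr_diag V e =
  congr_diag (U *t V)
    (\row_k (d 0 (mxtens_unindex k).1 * e 0 (mxtens_unindex k).2)).
Proof. by rewrite /congr_diag -tens_diag_mx trmx_tens !tensmx_mul. Qed.

(** Logarithms of Kronecker products are Kronecker sums. *)
Lemma expmx_tens_sum m n (K : 'M[R]_n) (M : 'M[R]_m) : K^T = K -> M^T = M ->
  expmx (K *t 1%:M + 1%:M *t M) = expmx K *t expmx M.
Proof.
move=> /sym_congr_diag[U [d [UU ->]]] /sym_congr_diag[V [e [VV ->]]].
rewrite -(congr_diag_const 1 UU) -(congr_diag_const 1 VV) !tens_congr_diag.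
rewrite -congr_diagD !expmx_congr_diag // ?tens_congr_diag; last first.
  by rewrite trmx_tens tensmx_mul UU VV tensmx1.
by congr congr_diag; apply/rowP => k; rewrite !mxE mulr1 mul1r expRD.
Qed.

Lemma spd_tens m n (A : 'M[R]_m) (B : 'M[R]_n) :
  spd A -> spd B -> spd (B *t A).
Proof.
move=> /spd_expmxP[M sM ->] /spd_expmxP[K sK ->]; rewrite -expmx_tens_sum //.
by apply: spd_expmx; rewrite linearD /= !trmx_tens !trmx1 sM sK.
Qed.

End Tensor.

Section TwoByTwo.
Variable R : realType.

Definition rot90 : 'M[R]_2 :=
  \matrix_(i, j) (if i == j then 0 else if i == 0 then 1 else -1).

Lemma rot90E :
  (rot90 0 0 = 0) * (rot90 0 1 = 1) * (rot90 1 0 = -1) * (rot90 1 1 = 0).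
Proof. by do !split; rewrite mxE. Qed.

(** The Gram matrix of the polar form of the determinant, a quadratic form of
    signature (2,2) on the two by two matrices. *)
Definition detform : 'M[R]_(2 * 2) := rot90 *t rot90.

Lemma sum_ord2 (F : 'I_2 -> R) : \sum_i F i = F 0 + F 1.
Proof. by rewrite big_ord_recl big_ord1; congr (_ + F _); apply: val_inj. Qed.

Lemma mulmx2E m n (A : 'M[R]_(m, 2)) (B : 'M[R]_(2, n)) i j :
  (A *m B) i j = A i 0 * B 0 j + A i 1 * B 1 j.
Proof. by rewrite mxE sum_ord2. Qed.

Lemma ord2P (P : 'I_2 -> Prop) : P 0 -> P 1 -> forall i, P i.
Proof.
move=> P0 P1 [[|[|//]] h].
  by suff -> : Ordinal h = 0 by []; apply: val_inj.
by suff -> : Ordinal h = 1 by []; apply: val_inj.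
Qed.

Lemma rot90T : rot90^T = - rot90.
Proof.
apply/matrixP; do 2 apply: ord2P;
  by rewrite [LHS]mxE [RHS]mxE !rot90E ?oppr0 ?opprK.
Qed.

Lemma rot90_sq : rot90 *m rot90 = - 1%:M.
Proof.
apply/matrixP; do 2 apply: ord2P; rewrite !mulmx2E !rot90E !mxE /=; ring.
Qed.

Lemma detform_sym : detform^T = detform.
Proof.
by rewrite trmx_tens rot90T; apply/matrixP => i j; rewrite !mxE mulrNN.
Qed.

Lemma detform_sq : detform *m detform = 1%:M.
Proof.
rewrite tensmx_mul rot90_sq -[RHS]tensmx1.
by apply/matrixP => i j; rewrite !mxE mulrNN.
Qed.

Lemma det2_congr (A : 'M[R]_2) : A^T = A ->
  A *m rot90 *m A = (A 0 0 * A 1 1 - A 0 1 ^+ 2) *: rot90.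
Proof.
move=> sA; have A10 : A 1 0 = A 0 1 by rewrite -{1}sA mxE.
apply/matrixP; do 2 apply: ord2P; rewrite [RHS]mxE !mulmx2E !rot90E ?A10; ring.
Qed.

(** The value of the form at [(- A 0 1, A 0 0)] is [A 0 0] times the determinant. *)
Lemma spd2_det_gt0 (A : 'M[R]_2) : spd A -> 0 < A 0 0 * A 1 1 - A 0 1 ^+ 2.
Proof.
move=> pA; have A00 := spd_diag_gt0 0 pA.
pose v : 'cV[R]_2 := \col_i (if i == 0 then - A 0 1 else A 0 0).
have v0 : v != 0.
  by apply/eqP => /matrixP/(_ 1 0)/eqP; rewrite !mxE /= gt_eqF.
have := pA.2 _ v0; rewrite -/(qform A v v).
have -> : qform A v v = A 0 0 * (A 0 0 * A 1 1 - A 0 1 ^+ 2).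
  have A10 : A 1 0 = A 0 1 by rewrite -{1}pA.1 mxE.
  rewrite /qform !mulmx2E !mxE /= A10; ring.
by rewrite pmulr_rgt0.
Qed.

(** A local change of coordinates multiplies the determinant form by the
    determinants of its two factors. *)
Lemma kron_family2_detform (G : 'M[R]_(2 * 2)) : @kron_family R 2 2 G ->
  spd G /\ exists2 k : R, 0 < k & G *m detform *m G = k *: detform.
Proof.
move=> [A [B [pA pB ->]]]; split; first exact: spd_tens.
exists ((B 0 0 * B 1 1 - B 0 1 ^+ 2) * (A 0 0 * A 1 1 - A 0 1 ^+ 2)).
  by rewrite mulr_gt0 // spd2_det_gt0.
rewrite !tensmx_mul (det2_congr pA.1) (det2_congr pB.1).
by rewrite tensmxZl tensmxZr scalerA.
Qed.

End TwoByTwo.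

(** * The two by two Kronecker family as a set of similitudes *)

Section TwoByTwoConverse.
Variable R : realType.

Lemma sum_tens m n (F : 'I_(m * n) -> R) :
  \sum_k F k = \sum_i \sum_j F (mxtens_index (i, j)).
Proof.
rewrite pair_big /=; rewrite (reindex (@mxtens_index m n)) /=.
  by apply: eq_bigr => -[].
by exists (@mxtens_unindex m n) => k _; rewrite (mxtens_indexK, mxtens_unindexK).
Qed.

Lemma qformE n (A : 'M[R]_n) x y :
  qform A x y = \sum_i \sum_j x i 0 * A i j * y j 0.
Proof.
rewrite /qform mxE exchange_big; apply: eq_bigr => j _.
by rewrite mxE mulr_suml; apply: eq_bigr => i _; rewrite mxE.
Qed.

Definition tens_col m n (x : 'cV[R]_m) (y : 'cV[R]_n) : 'cV[R]_(m * n) :=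
  \col_k (x (mxtens_unindex k).1 0 * y (mxtens_unindex k).2 0).

Lemma qform_tens m n (B : 'M[R]_m) (A : 'M[R]_n) x y :
  qform (B *t A) (tens_col x y) (tens_col x y) = qform B x x * qform A y y.
Proof.
rewrite !qformE sum_tens big_distrlr /=; apply: eq_bigr => i _.
apply: eq_bigr => j _; rewrite sum_tens big_distrlr /=; apply: eq_bigr => p _.
by apply: eq_bigr => q _; rewrite tensmxE !mxE !mxtens_indexK /=; ring.
Qed.

(** Positivity on product vectors forces the two factors to be definite of the
    same sign, which the normalization [B 0 0 = 1] makes positive. *)
Lemma spd_tensP m n (B : 'M[R]_m.+1) (A : 'M[R]_n.+1) :
  A^T = A -> B^T = B -> B 0 0 = 1 -> spd (B *t A) -> spd A /\ spd B.
Proof.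
move=> sA sB B00 [_ pBA].
have tens_neq0 (x : 'cV[R]_m.+1) (y : 'cV[R]_n.+1) : x != 0 -> y != 0 ->
    0 < qform B x x * qform A y y.
  move=> x0 y0; rewrite -qform_tens; apply: pBA.
  apply: contraNneq x0 => xy0; apply/eqP/colP => i; rewrite mxE.
  have [j yj] := col_neq0P y0.
  have := congr1 (fun M : 'cV[R]_(m.+1 * n.+1) => M (mxtens_index (i, j)) 0) xy0.
  rewrite /= !mxE mxtens_indexK /= => /eqP.
  by rewrite mulf_eq0 (negbTE yj) orbF => /eqP.
have pA : spd A.
  split=> // y y0; have := tens_neq0 _ _ (delta_col_neq0 R 0) y0.
  by rewrite qform_delta B00 mul1r.
split=> //; split=> // x x0; have := tens_neq0 _ _ x0 (delta_col_neq0 R 0).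
by rewrite pmulr_lgt0 //; exact: (pA.2 _ (delta_col_neq0 R 0)).
Qed.

(** The scalar content of [kron_family2_of_detform]: the [ai], [bi], [di] are the
    entries of the upper left, upper right and lower right blocks of [G], and the
    equations are entries of [G *m detform *m G = k *: detform]. The first three
    make the upper right block proportional to the upper left one, and the last
    three then do the same for the lower right block. *)
Lemma proportional_blocks (a0 a1 a2 b0 b1 b2 b3 d0 d1 d2 k : R) :
  0 < a0 -> 0 < a2 -> 0 < a0 * a2 - a1 ^+ 2 ->
  a0 * b1 = a1 * b0 -> a1 * b3 = a2 * b2 ->
  a0 * b3 - a1 * b2 - b0 * a2 + b1 * a1 = 0 ->
  a0 * d1 - a1 * d0 - b0 * b2 + b1 * b0 = 0 ->
  a0 * d2 - a1 * d1 - b0 * b3 + b1 * b1 = k ->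
  a1 * d1 - a2 * d0 - b2 * b2 + b3 * b0 = - k ->
  let b := b0 / a0 in let d := d0 / a0 in
  [/\ b1 = b * a1, b2 = b * a1, b3 = b * a2, d1 = d * a1 & d2 = d * a2].
Proof.
move=> a0_gt0 a2_gt0 det_gt0 E1 E2 E3 E4 E5 E6 b d.
have a0_neq0 : a0 != 0 by rewrite gt_eqF.
have b0E : b0 = b * a0 by rewrite /b divfK.
have d0E : d0 = d * a0 by rewrite /d divfK.
have b1E : b1 = b * a1.
  by apply: (mulfI a0_neq0); rewrite E1 b0E; ring.
have b3E : b3 = b * a2.
  apply: (mulfI (lt0r_neq0 det_gt0)); apply/eqP; rewrite -subr_eq0; apply/eqP.
  have -> : (a0 * a2 - a1 ^+ 2) * b3 - (a0 * a2 - a1 ^+ 2) * (b * a2)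
     = a2 * (a0 * b3 - a1 * b2 - b0 * a2 + b1 * a1)
       - a1 * (a1 * b3 - a2 * b2) by rewrite b0E b1E; ring.
  by rewrite E3 E2 subrr !mulr0 subrr.
have b2E : b2 = b * a1.
  by apply: (mulfI (lt0r_neq0 a2_gt0)); rewrite -E2 b3E; ring.
split=> //.
  apply: (mulfI a0_neq0); move: E4; rewrite b1E b2E b0E d0E; lra.
apply: (mulfI a0_neq0); move: E5 E6; rewrite b1E b2E b3E b0E d0E; lra.
Qed.

(** Converse of [kron_family2_detform]: the Kronecker family is cut out of the
    positive-definite cone by the similitudes of the determinant form. *)
Lemma kron_family2_of_detform (G : 'M[R]_(2 * 2)) k :
  spd G -> G *m @detform R *m G = k *: @detform R -> @kron_family R 2 2 G.
Proof.
move=> pG EG; pose ix i j : 'I_(2 * 2) := @mxtens_index 2 2 (i, j).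
pose g i j p q := G (ix i j) (ix p q).
have gC i j p q : g i j p q = g p q i j by rewrite /g -{1}pG.1 mxE.
have sum4 (F : 'I_(2 * 2) -> R) : \sum_i F i =
    F (ix 0 0) + F (ix 0 1) + (F (ix 1 0) + F (ix 1 1)).
  by rewrite sum_tens !sum_ord2.
(* [detform] has only four nonzero entries. *)
have E i j p q : g i j 0 0 * g 1 1 p q - g i j 0 1 * g 1 0 p q
    - g i j 1 0 * g 0 1 p q + g i j 1 1 * g 0 0 p q =
    k * (@rot90 R i p * @rot90 R j q).
  have := congr1 (fun M : 'M[R]_(2 * 2) => M (ix i j) (ix p q)) EG.
  rewrite /= [RHS]mxE tensmxE => <-.
  have GQ r s : (G *m @detform R) (ix i j) (ix r s) =
      g i j 0 0 * (@rot90 R 0 r * @rot90 R 0 s)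
      + g i j 0 1 * (@rot90 R 0 r * @rot90 R 1 s)
      + (g i j 1 0 * (@rot90 R 1 r * @rot90 R 0 s)
      + g i j 1 1 * (@rot90 R 1 r * @rot90 R 1 s)).
    by rewrite mxE sum4 !tensmxE.
  by rewrite mxE sum4 !GQ !rot90E /g; ring.
(* The upper left block is the restriction of [G] to the products with the first
   basis vector, hence is definite. *)
pose a : 'M[R]_2 := \matrix_(j, l) g 0 j 0 l.
have pa : spd a.
  split=> [|y y0]; first by apply/matrixP => i j; rewrite !mxE gC.
  pose v : 'cV[R]_(2 * 2) := \col_c
    (if (mxtens_unindex c).1 == 0 then y (mxtens_unindex c).2 0 else 0).
  have v0 : v != 0.
    apply: contraNneq y0 => v0; apply/eqP/colP => j.
    have := congr1 (fun M : 'cV[R]_(2 * 2) => M (ix 0 j) 0) v0.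
    by rewrite /= !mxE mxtens_indexK /=.
  have := pG.2 _ v0; rewrite -!/(qform _ _ _) !qformE !sum4 !sum_ord2.
  by rewrite !mxE !mxtens_indexK /= /g !mulr0 !mul0r !addr0.
have a0 : 0 < g 0 0 0 0 by have := spd_diag_gt0 0 pa; rewrite mxE.
have a2 : 0 < g 0 1 0 1 by have := spd_diag_gt0 1 pa; rewrite mxE.
have det0 := spd2_det_gt0 pa; rewrite !mxE in det0.
have E1 := E 0 0 0 0; have E2 := E 0 1 0 1; have E3 := E 0 0 0 1.
have E4 := E 0 0 1 0; have E5 := E 0 0 1 1; have E6 := E 0 1 1 0.
rewrite !rot90E (gC 1 1 0 0) (gC 1 0 0 0) (gC 0 1 0 0) in E1.
rewrite !rot90E (gC 0 1 0 0) (gC 1 1 0 1) (gC 1 0 0 1) in E2.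
rewrite !rot90E (gC 1 1 0 1) (gC 1 0 0 1) in E3.
rewrite !rot90E (gC 1 1 1 0) in E4; rewrite !rot90E in E5.
rewrite !rot90E (gC 0 1 0 0) (gC 1 1 1 0) in E6.
have [||||||] := @proportional_blocks (g 0 0 0 0) (g 0 0 0 1) (g 0 1 0 1)
  (g 0 0 1 0) (g 0 0 1 1) (g 0 1 1 0) (g 0 1 1 1) (g 1 0 1 0) (g 1 0 1 1)
  (g 1 1 1 1) k a0 a2 det0; try lra.
set b := _ / _; set d := _ / _ => b1E b2E b3E d1E d2E.
pose B : 'M[R]_2 := \matrix_(i, p)
  (if i == 0 then if p == 0 then 1 else b else if p == 0 then b else d).
have b0E : g 0 0 1 0 = b * g 0 0 0 0 by rewrite /b divfK // gt_eqF.
have d0E : g 1 0 1 0 = d * g 0 0 0 0 by rewrite /d divfK // gt_eqF.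
have GE : G = B *t a.
  apply/matrixP => r s.
  case: (mxtens_indexP r) => i j; case: (mxtens_indexP s) => p q.
  rewrite tensmxE -/(ix i j) -/(ix p q) -/(g i j p q).
  move: i j p q; do 4 apply: ord2P; rewrite !mxE /= ?mul1r //;
    by rewrite ?(gC 1 _ 0 _) ?(gC 0 1 0 0) ?(gC 1 1 1 0).
have sa := pa.1.
have sB : B^T = B by apply/matrixP; do 2 apply: ord2P; rewrite !mxE.
have [||] := @spd_tensP 1 1 B a sa sB; first by rewrite !mxE.
  by rewrite -GE.
by move=> _ pB; exists a, B.
Qed.

End TwoByTwoConverse.

(** * Optimality of kappa under an involution *)

Section Involution.
Variables (R : realType) (n : nat) (Q : 'M[R]_n).
Hypotheses (symQ : Q^T = Q) (QQ : Q *m Q = 1%:M).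
Implicit Types (G H L Y S : 'M[R]_n) (v w x y : 'cV[R]_n).

(** [Q] acts on the eigenspace; take [v + Q *m v], or [v] if that vanishes. *)
Lemma involution_eigenvector H a v :
  Q *m H = H *m Q -> v != 0 -> H *m v = a *: v ->
  exists x s, [/\ x != 0, H *m x = a *: x, Q *m x = s *: x & s ^+ 2 = 1].
Proof.
move=> QH v0 Hv; have [vQ|vQ] := eqVneq (v + Q *m v) 0.
  exists v, (-1); split=> //; last by rewrite sqrrN expr1n.
  by rewrite scaleN1r; apply/eqP; rewrite -addr_eq0 addrC vQ.
exists (v + Q *m v), 1; split=> //; last by rewrite expr1n.
  by rewrite mulmxDr mulmxA -QH -mulmxA Hv -scalemxAr scalerDr.
by rewrite scale1r mulmxDr mulmxA QQ mul1mx addrC.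
Qed.

Section Member.
Variables (G : 'M[R]_n) (k : R).
Hypotheses (pG : spd G) (k0 : 0 < k) (GQG : G *m Q *m G = k *: Q).

(** The relation between [G] and [Q] makes [Q *m (G *m v)] a multiple of
    [invmx G *m v], so that testing against this vector compares the form [invmx G]
    with the form [G]. *)
Lemma involution_test v s : Q *m v = s *: v -> s ^+ 2 = 1 ->
  let y := Q *m (G *m v) in
  G *m y = (k * s) *: v /\ qform G y y = k * qform G v v.
Proof.
move=> Qv s2 y; have Gy : G *m y = (k * s) *: v.
  by rewrite /y !mulmxA GQG -scalemxAl Qv scalerA.
split=> //; rewrite /qform -mulmxA Gy -scalemxAr [in LHS]/y !trmx_mul symQ pG.1.
rewrite -(mulmxA _ Q) Qv -scalemxAr scalerA mxE; congr (_ * _).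
by rewrite -mulrA -expr2 s2 mulr1.
Qed.

Lemma involution_qform_ge v s : Q *m v = s *: v -> s ^+ 2 = 1 ->
  k * qform 1%:M v v ^+ 2 <= qform G v v ^+ 2.
Proof.
move=> Qv s2; have [Gy Gyy] := involution_test Qv s2.
set y := Q *m (G *m v) in Gy Gyy.
have Gvy : qform G v y = k * s * qform 1%:M v v.
  by rewrite /qform -mulmxA Gy -scalemxAr mxE mulmx1.
have := qform_cauchy_schwarz v y pG; rewrite Gyy Gvy !exprMn s2 mulr1 => h.
by rewrite -(ler_pM2l k0); move: h; lra.
Qed.

(** Cauchy-Schwarz for the form [H] between [v] and the test vector. *)
Lemma involution_upper H a a' v s : spd H -> 0 < a -> v != 0 ->
  H *m v = a *: v -> Q *m v = s *: v -> s ^+ 2 = 1 ->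
  (forall x, qform H x x <= a' * qform G x x) ->
  a * qform G v v <= a' * (k * qform 1%:M v v).
Proof.
move=> pH a_gt0 v0 Hv Qv s2 Ha'; have [Gy Gyy] := involution_test Qv s2.
set y := Q *m (G *m v) in Gy Gyy.
have p0 : 0 < qform G v v by exact: pG.2.
have Hvv : qform H v v = a * qform 1%:M v v.
  by rewrite /qform -mulmxA Hv -scalemxAr mxE mulmx1.
have Hvy : qform H v y = a * s * qform G v v.
  rewrite qformC ?pH.1 // /qform -mulmxA Hv -scalemxAr mxE -mulrA; congr (_ * _).
  by rewrite /y !trmx_mul symQ pG.1 -mulmxA Qv -scalemxAr mxE.
have := qform_cauchy_schwarz v y pH; rewrite Hvv Hvy.
have : qform H y y <= a' * (k * qform G v v) by rewrite -Gyy.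
have nu0 : 0 <= qform 1%:M v v by rewrite qform1 sumr_ge0 // => i _; exact: sqr_ge0.
move=> /(ler_wpM2l (mulr_ge0 (ltW a_gt0) nu0)) h1 h2.
have := le_trans h2 h1; rewrite !exprMn s2 mulr1.
set p := qform G v v in p0 *; set nu := qform _ v v => h.
rewrite -(ler_pM2l (mulr_gt0 a_gt0 p0)); move: h; lra.
Qed.
End Member.
End Involution.

(** Let [v] and [w] be extreme eigenvectors of [H] that are also eigenvectors of
    [Q]. By Rayleigh quotients, passing from the identity to [G] multiplies the
    largest generalized eigenvalue by at least the value of [invmx G] at the unit
    vector along [v], and divides the smallest one by at least the value of [G] at
    the unit vector along [w]. By [involution_qform_ge] these values are at least
    [1 / sqrt k] and [sqrt k], so that the ratio cannot decrease. *)
Lemma kappa_involution_min (R : realType) n (Q G H : 'M[R]_n.+1) k :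
  Q^T = Q -> Q *m Q = 1%:M -> spd H -> Q *m H = H *m Q ->
  spd G -> 0 < k -> G *m Q *m G = k *: Q ->
  kappa 1%:M H <= kappa G H.
Proof.
move=> symQ QQ pH QH pG k0 GQG.
have p1 := spd1 R n.+1.
have [a [b [b0 -> [v0 v00 Hv0] [w0 w00 Hw0] ab]]] := kappa_extremes p1 pH.
have [a' [b' [b'0 -> _ _ ab']]] := kappa_extremes pG pH.
rewrite mul1mx in Hv0; rewrite mul1mx in Hw0.
have [v [s [v_neq0 Hv Qv s2]]] := involution_eigenvector QQ QH v00 Hv0.
have [w [t [w_neq0 Hw Qw t2]]] := involution_eigenvector QQ QH w00 Hw0.
have nuv : 0 < qform 1%:M v v by exact: p1.2.
have nuw : 0 < qform 1%:M w w by exact: p1.2.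
have pv : 0 < qform G v v by exact: pG.2.
have pw : 0 < qform G w w by exact: pG.2.
have a0 : 0 < a.
  have /andP[h1 h2] := ab v; rewrite -(pmulr_lgt0 _ nuv); apply: lt_le_trans h2.
  exact: pH.2.
have Hww : qform H w w = b * qform 1%:M w w.
  by rewrite /qform -mulmxA Hw -scalemxAr mxE mulmx1.
have up := involution_upper symQ pG GQG pH a0 v_neq0 Hv Qv s2
  (fun x => proj2 (andP (ab' x))).
have /andP[lo _] := ab' w; rewrite Hww in lo.
have kv := involution_qform_ge symQ pG k0 GQG Qv s2.
have kw := involution_qform_ge symQ pG k0 GQG Qw t2.
move: (qform G v v) (qform G w w) (qform 1%:M v v) (qform 1%:M w w)
  nuv nuw pv pw up lo kv kw {ab ab' Hww}.
move=> p q nu mu nu0 mu0 p0 q0 up lo kv kw.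
have pq : k * (nu * mu) <= p * q.
  rewrite -(@ler_pXn2r _ 2%N) ?nnegrE ?mulr_ge0 ?(ltW k0) ?(ltW nu0) ?(ltW mu0)
    ?(ltW p0) ?(ltW q0) //.
  have h := ler_pM (mulr_ge0 (ltW k0) (sqr_ge0 nu))
    (mulr_ge0 (ltW k0) (sqr_ge0 mu)) kv kw.
  have -> : (p * q) ^+ 2 = p ^+ 2 * q ^+ 2 by ring.
  by apply: le_trans h; rewrite le_eqVlt; apply/orP; left; apply/eqP; ring.
rewrite ler_pdivrMr // mulrAC ler_pdivlMr //.
have knm : 0 < k * (nu * mu) by rewrite !mulr_gt0.
rewrite -(ler_pM2r knm).
apply: (@le_trans _ _ (a * b' * (p * q))); first by rewrite ler_pM2l ?mulr_gt0.
have -> : a * b' * (p * q) = (a * p) * (b' * q) by ring.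
have -> : a' * b * (k * (nu * mu)) = (a' * (k * nu)) * (b * mu) by ring.
by apply: ler_pM; rewrite // ltW ?mulr_gt0.
Qed.

(** * The normal form relative to an involution *)

Section InvolutionNormalForm.
Variables (R : realType) (n : nat) (Q : 'M[R]_n.+1).
Hypotheses (symQ : Q^T = Q) (QQ : Q *m Q = 1%:M).
Implicit Types (G H L Y S P : 'M[R]_n.+1).

Lemma expmx_involution L : L^T = L ->
  expmx (Q *m L *m Q) = Q *m expmx L *m Q.
Proof.
by move=> sL; have := expmx_conj _ sL; rewrite -{2 4}symQ; apply; rewrite symQ.
Qed.

Lemma involution_sym L : L^T = L -> (Q *m L *m Q)^T = Q *m L *m Q.
Proof. by move=> sL; rewrite !trmx_mul symQ sL mulmxA. Qed.

Lemma involution_conj_mul M k : M *m Q *m M = k *: Q ->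
  Q *m M *m Q *m M = k%:M.
Proof.
move=> MQM; rewrite -(mulmxA (Q *m M) Q M) -(mulmxA Q M) (mulmxA M Q M) MQM.
by rewrite -scalemxAr QQ scale_scalar_mx mulr1.
Qed.

(** [P] is the geometric mean of [H] and [Q *m invmx H *m Q], hence a fixed point
    of the isometry [G |-> Q *m invmx G *m Q] which exchanges the two. In a basis
    orthonormal for [H] it is the absolute value of the form [Q]; the second
    relation says that [P] is the midpoint, cleared of inverses. *)
Lemma involution_mean H : spd H ->
  exists2 P, spd P & P *m Q *m P = Q /\ H *m Q *m P = P *m Q *m H.
Proof.
move=> pH; have [W [d [uW HE QE]]] := simultaneous_diag pH symQ.
(* As [Q] is its own inverse, its matrix in the dual basis is inverse to [d]. *)
pose N := W^T *m Q *m W.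
have ND : N *m diag_mx d = 1%:M.
  have : (W *m diag_mx d) *m (W^T *m Q) = 1%:M.
    by rewrite mulmxA -[W *m _ *m _]/(congr_diag W d) -QE.
  by move=> /mulmx1C <-; rewrite /N !mulmxA.
have d0 i : d 0 i != 0.
  apply/eqP => di; have := congr1 (fun M : 'M[R]_n.+1 => M i i) ND.
  by rewrite mul_mx_diag !mxE eqxx di mulr0 => /eqP; rewrite eq_sym oner_eq0.
have NE : N = diag_mx (\row_j (d 0 j)^-1).
  have DV : diag_mx d *m diag_mx (\row_j (d 0 j)^-1) = 1%:M.
    rewrite mulmx_diag -diag_const_mx; congr diag_mx; apply/rowP => j.
    by rewrite !mxE divff.
  by rewrite -[LHS]mulmx1 -DV mulmxA ND mul1mx.
pose P := congr_diag W (\row_j `|d 0 j|).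
exists P; first by apply: spd_congr_diag => // i; rewrite mxE normr_gt0.
split.
- have -> : P *m Q *m P = W *m (diag_mx (\row_j `|d 0 j|) *m N
      *m diag_mx (\row_j `|d 0 j|)) *m W^T.
    by rewrite /P /congr_diag /N !mulmxA.
  rewrite NE !mulmx_diag QE; congr (_ *m diag_mx _ *m _); apply/rowP => j.
  by rewrite !mxE mulrAC -normrM -expr2 ger0_norm ?sqr_ge0 // expr2 mulfK.
- have HQP : H *m Q *m P = W *m (N *m diag_mx (\row_j `|d 0 j|)) *m W^T.
    by rewrite HE /P /congr_diag /N !mulmxA.
  have : (H *m Q *m P)^T = H *m Q *m P.
    by rewrite HQP NE mulmx_diag; exact: congr_diag_sym.
  have sP : P^T = P by exact: congr_diag_sym.
  by rewrite (trmx_mul (H *m Q)) (trmx_mul H) symQ pH.1 sP mulmxA.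
Qed.

(** Both [S] and the trace condition come from one choice: [S] is the square root
    of the mean of [involution_mean], rescaled so that [L] loses its trace. *)
Lemma involution_normal_form H : spd H ->
  exists S L, [/\ S^T = S, S \in unitmx, L^T = L, \tr L = 0 &
    [/\ exists2 c, 0 < c & S *m Q *m S = c *: Q, Q *m L *m Q = L &
        H = S *m expmx L *m S]].
Proof.
move=> pH; have [P /spd_expmxP[p sp ->] [PQP HQP]] := involution_mean pH.
have sp2 := sym_scale 2^-1 sp.
(* The fixed point equation of the isometry, read on the logarithm of the mean;
   it then passes to the square root [T]. *)
have QpQ : Q *m p *m Q = - p.
  apply: expmx_inj; [exact: involution_sym | by rewrite linearN /= sp |].
  rewrite expmx_involution // expmxN //.
  rewrite -[LHS](mulmxK (expmx_unit sp)) (@involution_conj_mul _ 1) ?mul1mx //.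
  by rewrite scale1r.
pose T := expmx (2^-1 *: p); pose T' := expmx (- (2^-1 *: p)).
have TT' : T *m T' = 1%:M by exact: expmxNr.
have T'T : T' *m T = 1%:M by exact: mulmx1C.
have sT : T^T = T by exact: expmx_sym.
have sT' : T'^T = T' by apply: expmx_sym; rewrite linearN /= sp2.
have TT : T *m T = expmx p by exact: expmx_half.
have QTQ : Q *m T *m Q = T'.
  by rewrite -expmx_involution // -scalemxAr -scalemxAl QpQ scalerN.
have QT : Q *m T = T' *m Q by rewrite -QTQ -mulmxA QQ mulmx1.
have TQ : T *m Q = Q *m T' by rewrite -QTQ !mulmxA QQ mul1mx.
have TQT : T *m Q *m T = Q by rewrite TQ -mulmxA T'T mulmx1.
have uT' : T' \in unitmx by apply: expmx_unit; rewrite linearN /= sp2.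
have uT : T \in unitmx by exact: expmx_unit.
clearbody T T'.
have [L sL EL] : exists2 L, L^T = L & T' *m H *m T' = expmx L.
  by have := spd_congr uT' pH; rewrite sT' => /spd_expmxP[L sL ->]; exists L.
have HE : H = T *m expmx L *m T.
  by rewrite -EL !mulmxA TT' mul1mx -mulmxA T'T mulmx1.
have QLQ : Q *m L *m Q = L.
  apply: expmx_inj => //; first exact: involution_sym.
  rewrite expmx_involution // -EL.
  have E1 : T' *m (H *m Q *m expmx p) *m T' = T' *m H *m (Q *m T).
    by rewrite -TT !mulmxA -(mulmxA _ T T') TT' mulmx1.
  have E2 : T' *m (expmx p *m Q *m H) *m T' = T *m Q *m H *m T'.
    by rewrite -TT !mulmxA T'T mul1mx.
  have MQ : T' *m H *m T' *m Q = Q *m (T' *m H *m T').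
    by rewrite -(mulmxA _ T' Q) -QT -E1 HQP E2 TQ !mulmxA.
  by rewrite -MQ -mulmxA QQ mulmx1.
pose tau := \tr L / n.+1%:R.
have sL' : (L - tau%:M)^T = L - tau%:M by rewrite linearB /= tr_scalar_mx sL.
have e0 : 0 < expR (tau / 2) by exact: expR_gt0.
exists (expR (tau / 2) *: T), (L - tau%:M); split => //.
- by rewrite linearZ /= sT.
- by rewrite unitmxZ // unitfE gt_eqF.
- rewrite linearB /= mxtrace_scalar -[tau *+ _]mulr_natr.
  by rewrite divfK ?subrr // pnatr_eq0.
split.
- exists (expR tau); first exact: expR_gt0.
  rewrite -!scalemxAl -scalemxAr scalerA -expRD -mulrDl TQT.
  by congr (expR _ *: _); field.
- rewrite mulmxBr mulmxBl QLQ mul_mx_scalar -scalemxAl QQ.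
  by rewrite scale_scalar_mx mulr1.
- rewrite -raddfN expmxDscalar //= -!scalemxAl -!scalemxAr -scalemxAl !scalerA.
  rewrite -!expRD (_ : tau / 2 + (tau / 2 - tau) = 0) ?expR0 ?scale1r //.
  by field.
Qed.

(** Conjugation by [Q] fixes [L] and sends [Y] to [- Y], up to a scalar matrix that
    the traceless [L] does not see. *)
Lemma involution_log_orth L Y k : L^T = L -> Y^T = Y -> \tr L = 0 ->
  Q *m L *m Q = L -> 0 < k -> expmx Y *m Q *m expmx Y = k *: Q ->
  \tr (L *m Y) = 0.
Proof.
move=> sL sY trL QLQ k0 YQY.
have QYQ : Q *m Y *m Q = - Y + (ln k)%:M.
  have sNY : (- Y)^T = - Y by rewrite linearN /= sY.
  apply: expmx_inj; first exact: involution_sym.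
    by rewrite linearD /= tr_scalar_mx sNY.
  rewrite expmx_involution // expmxDscalar // lnK // expmxN //.
  rewrite -[LHS](mulmxK (expmx_unit sY)) (involution_conj_mul YQY).
  by rewrite mul_scalar_mx.
have : \tr (L *m Y) = \tr (L *m (Q *m Y *m Q)).
  by rewrite -{1}QLQ -!mulmxA mxtrace_mulC -!mulmxA.
rewrite QYQ mulmxDr linearD /= mulmxN linearN /= mul_mx_scalar linearZ /= trL.
by rewrite mulr0 addr0; lra.
Qed.

End InvolutionNormalForm.

(** * The case of two by two factors *)

Section TwoByTwoProjection.
Variable R : realType.
Local Notation Q := (@detform R).

Lemma involution_pullback n (Q' S G : 'M[R]_n) (c k : R) :
  S \in unitmx -> 0 < c -> S *m Q' *m S = c *: Q' ->
  (S *m G *m S) *m Q' *m (S *m G *m S) = k *: Q' ->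
  G *m Q' *m G = (k / c ^+ 2) *: Q'.
Proof.
move=> uS c0 SQS E; have c_neq0 : c != 0 by rewrite gt_eqF.
apply: (can_inj (mulKmx uS)); apply: (can_inj (mulmxK uS)).
have -> : S *m (G *m Q' *m G) *m S = c^-1 *: (k *: Q').
  rewrite -E -!mulmxA (mulmxA Q' S) (mulmxA S (Q' *m S)) (mulmxA S Q' S) SQS.
  by rewrite -scalemxAl -!scalemxAr scalerA mulVf // scale1r.
rewrite -scalemxAr -scalemxAl SQS !scalerA; congr (_ *: _).
by field.
Qed.

(** In the normal form of [H] the family becomes the set of similitudes of [Q]: the
    logarithm [L] of [H] is orthogonal to its logarithms, and it commutes with [Q].
    The first fact identifies the projection, the second makes it optimal. *)
Lemma kron22_proj_kappa_minimizer (H : 'M[R]_(2 * 2)) : spd H ->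
  exists P, is_kron_proj 2 2 H P /\ is_kappa_minimizer 2 2 H P.
Proof.
move=> pH.
have [S [L [sS uS sL trL [[c c0 SQS] QLQ HE]]]] : exists S L : 'M[R]_(2 * 2),
    [/\ S^T = S, S \in unitmx, L^T = L, \tr L = 0 &
      [/\ exists2 c, 0 < c & S *m Q *m S = c *: Q, Q *m L *m Q = L &
          H = S *m expmx L *m S]].
  (* The numeral 3 is the predecessor of the dimension 2 * 2. *)
  exact: (@involution_normal_form R 3 Q (detform_sym R) (detform_sq R) H pH).
have family_pullback G : @kron_family R 2 2 G ->
    exists G' k, [/\ spd G', G = S *m G' *m S^T, 0 < k & G' *m Q *m G' = k *: Q].
  move=> /kron_family2_detform[pG [k k0 GQG]].
  pose G' := invmx S *m G *m invmx S.
  have GE : G = S *m G' *m S by rewrite /G' !mulmxA mulmxV // mul1mx mulmxKV.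
  have sV : (invmx S)^T = invmx S by rewrite trmx_inv sS.
  exists G', (k / c ^+ 2); split.
  - by rewrite /G' -{2}sV; apply: spd_congr => //; rewrite unitmx_inv.
  - by rewrite sS.
  - by rewrite divr_gt0 ?exprn_gt0.
  - by apply: (involution_pullback uS c0 SQS); rewrite -GE.
have KP : @kron_family R 2 2 (S *m S^T).
  apply: (@kron_family2_of_detform _ _ (c * c)); first exact: spd_gram.
  rewrite sS -!mulmxA (mulmxA Q S) (mulmxA S (Q *m S)) (mulmxA S Q S) SQS.
  by rewrite -scalemxAl -scalemxAr (mulmxA S Q S) SQS scalerA.
have HE' : H = S *m expmx L *m S^T by rewrite sS.
exists (S *m S^T); split.
  apply: (proj_of_orthogonal_log uS sL HE' KP) => G /family_pullback.
  move=> [G' [k [/spd_expmxP[Y sY ->] GE k0 YQY]]]; exists Y; split => //.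
  have [sQ QQ] := (detform_sym R, detform_sq R).
  exact: (involution_log_orth sQ QQ sL sY trL QLQ k0 YQY).
split=> // G /family_pullback[G' [k [pG' -> k0 GQG]]].
have P1 : S *m S^T = S *m 1%:M *m S^T by rewrite mulmx1.
rewrite [leLHS]/= [leRHS]/= P1 HE' !kappa_congr //.
apply: (@kappa_involution_min R 3 Q G' (expmx L) k) => //.
- exact: detform_sym.
- exact: detform_sq.
- exact: spd_expmx.
rewrite -{2}QLQ (expmx_involution (detform_sym R) (detform_sq R)) //.
by rewrite -!mulmxA (detform_sq R) mulmx1.
Qed.

Lemma kron_proj_not_optimal_dim_ge6 (m n : nat) : (2 <= m)%N -> (2 <= n)%N ->
  (exists H : 'M[R]_(n * m), spd H /\ kron_proj_not_optimal m n H) ->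
  (6 <= m * n)%N.
Proof.
move=> m2 n2 [H [pH [P [projP notP]]]]; rewrite leqNgt; apply/negP => mn.
have Em : m = 2%N by nia.
have En : n = 2%N by nia.
subst m n; have [P' [projP' minP']] := kron22_proj_kappa_minimizer pH.
by apply: notP; rewrite -(projP'.2 _ projP.1).
Qed.

End TwoByTwoProjection.

(** * The two by three example *)

Section Example.
Variable R : realType.

Lemma expmx_diag n (d : 'rV[R]_n) : expmx (diag_mx d) = diag_mx (map_mx expR d).
Proof.
have cd1 e : congr_diag 1%:M e = diag_mx e :> 'M[R]_n.
  by rewrite /congr_diag mul1mx trmx1 mulmx1.
by rewrite -cd1 expmx_congr_diag ?cd1 // trmx1 mulmx1.
Qed.

(** Logarithms of the family are Kronecker sums, and a Kronecker product of
    traceless factors is trace-orthogonal to every Kronecker sum. *)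
Lemma kron_proj1_of_traceless m n (A : 'M[R]_m.+1) (B : 'M[R]_n.+1) :
  A^T = A -> B^T = B -> \tr A = 0 -> \tr B = 0 ->
  is_kron_proj m.+1 n.+1 (expmx (B *t A)) 1%:M.
Proof.
move=> sA sB trA trB; have sL : (B *t A)^T = B *t A by rewrite trmx_tens sA sB.
have P1 : (1%:M : 'M[R]_(n.+1 * m.+1)) = 1%:M *m 1%:M^T by rewrite trmx1 mulmx1.
rewrite P1; apply: (@proj_of_orthogonal_log R _ _ 1%:M (B *t A)) => //.
- exact: unitmx1.
- by rewrite mul1mx trmx1 mulmx1.
- by rewrite -P1; exists 1%:M, 1%:M; split; rewrite ?tensmx1 //; exact: spd1.
move=> G [A' [B' [/spd_expmxP[M sM ->] /spd_expmxP[K sK ->] ->]]].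
exists (K *t 1%:M + 1%:M *t M); split.
- by rewrite linearD /= !trmx_tens !trmx1 sK sM.
- by rewrite mul1mx trmx1 mulmx1 expmx_tens_sum.
- rewrite mulmxDr linearD /= !tensmx_mul !mulmx1 !mxtrace_tens trA trB.
  by rewrite mulr0 mul0r addr0.
Qed.

Lemma exA_trace : \tr (exA R) = 0.
Proof. by rewrite mxtrace_diag big_ord_recl big_ord1 !mxE /= subrr. Qed.

Lemma exB_trace : \tr (exB R) = 0.
Proof. by rewrite mxtrace_diag !big_ord_recl big_ord0 !mxE /=; lra. Qed.

(** The second matrix is diagonal, with entries the exponentials of [2], [1/2], [3/2]
    and of their opposites, so its condition number is [expR 4]. Dividing by the
    exponential of [exA / 4] in every block lowers the coefficients [2], [-1/2],
    [-3/2] of [exA] to [7/4], [-3/4], [-7/4]; the two extreme ones are now balanced,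
    and the condition number drops to [expR (7 / 2)]. *)
Lemma kappa_example_lt :
  kappa (1%:M *t expmx (4^-1 *: exA R)) (expmx (exB R *t exA R)) <
  kappa 1%:M (expmx (exB R *t exA R)).
Proof.
set H := expmx (exB R *t exA R); set G := _ *t _.
pose av (j : 'I_2) : R := [:: 1; -1]`_j.
pose bv (i : 'I_3) : R := [:: 2; - (1 / 2); - (3 / 2)]`_i.
pose h : 'rV[R]_(3 * 2) :=
  \row_k expR (bv (mxtens_unindex k).1 * av (mxtens_unindex k).2).
pose g : 'rV[R]_(3 * 2) := \row_k expR (4^-1 * av (mxtens_unindex k).2).
have HE : H = diag_mx h.
  rewrite /H /exA /exB tens_diag_mx expmx_diag; congr diag_mx.
  by apply/rowP => k; rewrite !mxE.
have GE : G = diag_mx g.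
  rewrite /G /exA -linearZ /= expmx_diag -diag_const_mx tens_diag_mx.
  by congr diag_mx; apply/rowP => k; rewrite !mxE mul1r.
have spd_diag n (d : 'rV[R]_n) : (forall i, 0 < d 0 i) -> spd (diag_mx d).
  move=> d0; have := spd_congr_diag (unitmx1 R n) d0.
  by rewrite /congr_diag mul1mx trmx1 mulmx1.
have pH : spd (diag_mx h) by apply: spd_diag => i; rewrite mxE expR_gt0.
have pG : spd (diag_mx g) by apply: spd_diag => i; rewrite mxE expR_gt0.
have p1 := spd1 R (3 * 2).
(* The numeral 5 is the predecessor of the dimension 3 * 2. *)
have [a [b [b0 kE _ _ ab]]] := @kappa_extremes R 5 _ _ p1 pH.
have [a' [b' [b'0 kE' ga' gb' _]]] := @kappa_extremes R 5 _ _ pG pH.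
rewrite HE GE kE kE' {kE kE' HE GE H G}.
have hE i j : h 0 (@mxtens_index 3 2 (i, j)) = expR (bv i * av j).
  by rewrite mxE mxtens_indexK.
have ab_diag k : b <= h 0 k <= a.
  have := ab (delta_mx k 0).
  by rewrite !qform_delta !mxE !eqxx !mulr1n !mulr1.
have a_ge : expR 2 <= a.
  have /andP[_] := ab_diag (@mxtens_index 3 2 (0, 0)); rewrite hE.
  by rewrite /bv /av /= mulr1.
have b_le : b <= expR (- 2).
  have /andP[+ _] := ab_diag (@mxtens_index 3 2 (0, 1)); rewrite hE.
  by rewrite /bv /av /= mulrN1.
have gen_bound c : gen_eigenvalues (diag_mx g) (diag_mx h) c ->
    expR (- (7 / 4)) <= c <= expR (7 / 4).
  move=> /gen_eigenvalue_diag[k]; case: (mxtens_indexP k) => i j.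
  rewrite hE mxE mxtens_indexK /= => E.
  have -> : c = expR ((bv i - 4^-1) * av j).
    by rewrite mulrBl expRD expRN E mulfK // gt_eqF // expR_gt0.
  rewrite !ler_expR /bv /av.
  case: i {E} => [[|[|[|//]]] hi]; case: j => [[|[|//]] hj] /=; lra.
have /andP[a'_ge a'_le] := gen_bound _ ga'.
have a'0 : 0 <= a' := le_trans (expR_ge0 _) a'_ge.
have /andP[b'_ge _] := gen_bound _ gb'.
apply: (@le_lt_trans _ _ (expR (7 / 4) / expR (- (7 / 4)))).
  by apply: ler_pM; rewrite ?invr_ge0 ?(ltW b'0) ?lef_pV2 ?posrE ?expR_gt0.
apply: (@lt_le_trans _ _ (expR 2 / expR (- 2))).
  by rewrite -!expRN !opprK -!expRD ltr_expR; lra.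
by apply: ler_pM; rewrite ?invr_ge0 ?expR_ge0 ?lef_pV2 ?posrE ?expR_gt0.
Qed.

Lemma kron23_proj_not_optimal : let H : 'M[R]_(3 * 2) := expmx (exB R *t exA R) in
  spd H /\ kron_proj_not_optimal 2 3 H.
Proof.
move=> H; have sA : (exA R)^T = exA R by exact: tr_diag_mx.
have sB : (exB R)^T = exB R by exact: tr_diag_mx.
split; first by apply: spd_expmx; rewrite trmx_tens sA sB.
exists 1%:M; split.
  exact: (@kron_proj1_of_traceless 1 2 _ _ sA sB exA_trace exB_trace).
have sA4 : (4^-1 *: exA R)^T = 4^-1 *: exA R by rewrite linearZ /= sA.
move=> [_ /(_ (1%:M *t expmx (4^-1 *: exA R)))]; rewrite leNgt kappa_example_lt.
suff K : @kron_family R 2 3 (1%:M *t expmx (4^-1 *: exA R)) by move=> /(_ K).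
exists (expmx (4^-1 *: exA R)), 1%:M.
by split => //; [exact: spd_expmx | exact: spd1].
Qed.

End Example.

(** * The theorem *)

Theorem corollary5p11 (R : realType) :
  [/\ (forall H : 'M[R]_(2 * 2), spd H ->
         exists P : 'M[R]_(2 * 2),
           is_kron_proj 2 2 H P /\ is_kappa_minimizer 2 2 H P),
      (forall m n : nat, (2 <= m)%N -> (2 <= n)%N ->
         (exists H : 'M[R]_(n * m), spd H /\ kron_proj_not_optimal m n H) ->
         (6 <= m * n)%N),
      (let H : 'M[R]_(3 * 2) := expmx (exB R *t exA R) in
         spd H /\ kron_proj_not_optimal 2 3 H)
    & (forall m n : nat, (2 <= m)%N -> (2 <= n)%N ->
         (exists H : 'M[R]_(n * m), spd H /\ kron_proj_not_optimal m n H) ->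
         (2 * 3 <= m * n)%N)].
Proof.
split.
- by move=> H; exact: kron22_proj_kappa_minimizer.
- exact: kron_proj_not_optimal_dim_ge6.
- exact: kron23_proj_not_optimal.
- exact: kron_proj_not_optimal_dim_ge6.
Qed.
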